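(* Fix $\Delta t>0$, $\nu>0$, $f^{\{k\}}\in V_h$. Let $\{f^\ell,\bm\rho^\ell\}_\ell$, with $f^\ell\in V_h$ and $\bm\rho^\ell\in[V_{x,h}]^3$, be generated by the HOLO iteration: for every $\ell\ge 0$, $$(f^{\ell+1},z_h)+\Delta t\,\mathcal{L}(f^{\ell+1},z_h)=(f^{\{k\}},z_h)+\Delta t\,\nu\,(M(\bm\rho^{\ell+1}),z_h)-\Delta t\,\mathcal{B}(f_-^\ell,z_h)\qquad\forall z_h\in\widehat V_h,$$ $$(\bm\rho^{\ell+1},\bm q_h)_{\Omega_x}+\Delta t\,\mathcal{E}(\bm\rho^{\ell+1},\bm q_h)=(\bm\rho_{f^{\{k\}}},\bm q_h)_{\Omega_x}-\Delta t\big[\mathcal{A}(f^\ell,\bm e\cdot\bm q_h)-\mathcal{E}(\bm\rho_{f^\ell},\bm q_h)\big]-\Delta t\,\mathcal{B}(f_-^\ell,\bm e\cdot\bm q_h)\qquad\forall \bm q_h\in[V_{x,h}]^3 .$$ Suppose that $f^\ell\to f^*\in V_h$ and $\bm\rho^\ell\to\bm\rho^*\in[V_{x,h}]^3$ as $\ell\to\infty$, and that $\bm\rho^*=\bm\rho_{f^*}$. Then $f^*$ is a solution of the backward Euler discontinuous Galerkin discretization of the BGK equation, i.e. $$(f^*,z_h)+\Delta t\,\mathcal{L}(f^*,z_h)=(f^{\{k\}},z_h)+\Delta t\,\nu\,(M(\bm\rho_{f^*}),z_h)-\Delta t\,\mathcal{B}(f_-^*,z_h)\qquad\forall z_h\in\widehat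 V_h,$$ where $f_-^*$ is the inflow data evaluated with $f^*$.
   Context: Moments and Maxwellians. $\Omega_x=(a,b)\subset\mathbb{R}$; $\langle\cdot\rangle_v=\int_{\mathbb{R}}(\cdot)\,dv$; $\bm e=(1,v,\tfrac12v^2)^\top$; for a function $w$, $\bm\rho_w=\langle\bm e w\rangle_v$. A vector $\bm\eta$ written as $\bm\eta=(n,nu,\tfrac12n(u^2+\theta))^\top$ with $n>0$, $u\in\mathbb{R}$, $\theta>0$ is called realizable, and then $M(\bm\eta)(v)=\frac{n}{\sqrt{2\pi\theta}}\exp\left(-\frac{(v-u)^2}{2\theta}\right)$, so $\langle\bm e M(\bm\eta)\rangle_v=\bm\eta$. For moment fields $\bm\eta(x)$, $M(\bm\eta)$ is taken pointwise in $x$; all moment fields at which $M$ is evaluated (including limits such as $\bm\rho^*$ and $\bm\rho_{f^*}$) are assumed realizable at every $x$, including one-sided traces at cell endpoints. Discrete spaces. $\mathcal{T}_{x,h_x}$ is a partition of $\Omega_x$ into finitely many intervals, with set of interior nodes $E^{\mathrm I}_{x,h}$. $V_{x,h}$ is the space of functions on $\Omega_x$ that are polynomials of degree $\le\kappa$ on each cell, with no continuity between cells; $[V_{x,h}]^3$ is its vector-valued version. For $v_{\max}>0$ and $N_v$ a positive even integer, $\Omega_v=[-v_{\max},v_{\max}]$, $v_j=-v_{\max}+2jv_{\max}/N_v$, $I_j=(v_{j-1},v_j)$, $j=1,\dots,N_v$. $V_{v,h}$ is the space of functions on $\Omega_v$ that are polynomials of degree $\le2$ on each $I_j$, extended by zero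 to $\mathbb{R}$. Let $\hat I_1=(-\infty,v_1)$, $\hat I_{N_v}=(v_{N_v-1},\infty)$, $\hat I_j=I_j$ otherwise; $\widehat V_{v,h}$ is the space of functions on $\mathbb{R}$ that are polynomials of degree $\le2$ on each $\hat I_j$ (so $1,v,v^2\in\widehat V_{v,h}$). $V_h=V_{x,h}\otimes V_{v,h}$ (trial), $\widehat V_h=V_{x,h}\otimes\widehat V_{v,h}$ (test). $(\cdot,\cdot)_{\Omega_x}$ is the $L^2(\Omega_x)$ inner product and $(w,z)=\int_{\Omega_x\times\mathbb{R}}wz\,dx\,dv$. Forms. At an interior node, with left/right traces $q^-,q^+$: $\{\!\{q\}\!\}=\tfrac12(q^++q^-)$, $[\![q]\!]=q^--q^+$. Let $\partial\Omega_-=\{(a,v):v>0\}\cup\{(b,v):v<0\}$, $\partial\Omega_+=\{(a,v):v<0\}\cup\{(b,v):v>0\}$, and $\bm n=-1$ at $x=a$, $\bm n=+1$ at $x=b$. With $\widehat{vw}=v\{\!\{w\}\!\}+\tfrac{|v|}{2}[\![w]\!]$ and $\partial_{x,h}$ the cellwise $x$-derivative, $$\mathcal{A}(w,z)=-(vw,\partial_{x,h}z)+\sum_{x_e\in E^{\mathrm I}_{x,h}}\int_{\mathbb{R}}\widehat{vw}\,[\![z]\!]\Big|_{x_e}dv+\int_{\partial\Omega_+}vw\,z\,\bm n\,dv,\qquad \mathcal{B}(f_-,z)=\int_{\partial\Omega_-}vf_-\,z\,\bm n\,dv,$$ $\mathcal{L}(w,z)=\mathcal{A}(w,z)+\nu(w,z)$,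 and $\mathcal{E}(\bm\eta,\bm q_h)=\mathcal{A}(M(\bm\eta),\bm e\cdot\bm q_h)$ for $\bm\eta,\bm q_h\in[V_{x,h}]^3$. Inflow data. $f_-$ is the prescribed inflow data on $\partial\Omega_-$, which may depend on the interior solution $f\in V_h$; this dependence is assumed continuous on $V_h$ (so $f^\ell\to f^*$ implies $f_-^\ell\to f_-^*$ and $\mathcal{B}(f_-^\ell,z_h)\to\mathcal{B}(f_-^*,z_h)$ for each $z_h\in\widehat V_h$). $f_-^\ell$ denotes the inflow data evaluated with $f^\ell$. *)

(* Defs.v *)
From mathcomp Require Import all_boot all_order all_algebra.
From mathcomp Require Import all_classical all_reals all_analysis.
From mathcomp Require Import ring.
Import Order.TTheory GRing.Theory Num.Theory.
Import numFieldNormedType.Exports.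

Set Implicit Arguments.
Unset Strict Implicit.
Unset Printing Implicit Defensive.

Local Open Scope classical_set_scope.
Local Open Scope ring_scope.

(* Functions of x live on Omega_x = (a, b) but are represented by total
   functions on R; only their values on the open cells of the mesh, and
   one-sided limits of these, are ever used. *)

(** Meshes. [itv_partition a b s] says that a = x_0 < x_1 < ... < x_N = b,
    where s = [:: x_1; ...; x_N]. *)

Definition xcell (R : realType) (a : R) (s : seq R) (i : nat) : interval R :=
  `]nth a (a :: s) i, nth a (a :: s) i.+1[.

Definition xcells (R : realType) (a : R) (s : seq R) : set R :=
  \bigcup_(i in [set i | (i < size s)%N]) [set` xcell a s i].

Definition interior_nodes (R : realType) (a : R) (s : seq R) : seq R :=
  behead (belast a s).

Definition vnode (R : realType) (vmax : R) (Nv j : nat) : R :=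
  - vmax + 2 * j%:R * vmax / Nv%:R.

(* The velocity cells are indexed from 0: [vcell _ _ j] is I_(j+1). *)
Definition vcell (R : realType) (vmax : R) (Nv j : nat) : interval R :=
  `]vnode vmax Nv j, vnode vmax Nv j.+1[.

Definition vhatcell (R : realType) (vmax : R) (Nv j : nat) : interval R :=
  Interval (if j == 0%N then -oo%O else BRight (vnode vmax Nv j))
           (if j.+1 == Nv then +oo%O else BLeft (vnode vmax Nv j.+1)).

(** Discrete spaces *)

Definition piecewise_poly (R : realType) (d n : nat) (I : nat -> interval R)
    : set (R -> R) :=
  [set g | forall i, (i < n)%N -> exists p : {poly R},
     (size p <= d.+1)%N /\ {in I i, forall y, g y = p.[y]}].

Definition Vxh (R : realType) (a : R) (s : seq R) (kappa : nat)
    : set (R -> R) :=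
  piecewise_poly kappa (size s) (xcell a s).

Definition Vxh3 (R : realType) (a : R) (s : seq R) (kappa : nat)
    : set (R -> 'cV[R]_3) :=
  [set q | forall i, Vxh a s kappa (fun x => q x i 0)].

Definition Vvh (R : realType) (vmax : R) (Nv : nat) : set (R -> R) :=
  [set g | piecewise_poly 2 Nv (vcell vmax Nv) g /\
           forall v, v \notin `[- vmax, vmax] -> g v = 0].

Definition Vvhhat (R : realType) (vmax : R) (Nv : nat) : set (R -> R) :=
  piecewise_poly 2 Nv (vhatcell vmax Nv).

Definition tensor (R : realType) (A B : set (R -> R)) : set (R -> R -> R) :=
  [set w | exists (m : nat) (phi psi : 'I_m -> R -> R),
     [/\ forall k, A (phi k), forall k, B (psi k) &
         forall x v, w x v = \sum_(k < m) phi k x * psi k v]].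

Definition Vh (R : realType) (a : R) (s : seq R) (kappa : nat)
    (vmax : R) (Nv : nat) : set (R -> R -> R) :=
  tensor (Vxh a s kappa) (Vvh vmax Nv).

Definition Vhhat (R : realType) (a : R) (s : seq R) (kappa : nat)
    (vmax : R) (Nv : nat) : set (R -> R -> R) :=
  tensor (Vxh a s kappa) (Vvhhat vmax Nv).

(** Inner products and convergence *)

Definition inner_xv (R : realType) (a b : R) (w z : R -> R -> R) : R :=
  \int[(lebesgue_measure \x lebesgue_measure)%E]_(xv in `]a, b[ `*` setT)
     (w xv.1 xv.2 * z xv.1 xv.2).

Definition inner_x (R : realType) (a b : R) (eta q : R -> 'cV[R]_3) : R :=
  \int[lebesgue_measure]_(x in `]a, b[) (\sum_(i < 3) eta x i 0 * q x i 0).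

(* Vh and Vxh3 are finite-dimensional (modulo equality a.e.), so that all norms
   define the same convergence; we use the L^2 norm. *)
Definition cvg_Vh (R : realType) (a b : R)
    (w : nat -> R -> R -> R) (wlim : R -> R -> R) : Prop :=
  inner_xv a b (w l \- wlim) (w l \- wlim) @[l --> \oo] --> (0 : R).

Definition cvg_Vxh3 (R : realType) (a b : R)
    (eta : nat -> R -> 'cV[R]_3) (etalim : R -> 'cV[R]_3) : Prop :=
  inner_x a b (eta l \- etalim) (eta l \- etalim) @[l --> \oo] --> (0 : R).

(** Moments and Maxwellians *)

Definition evec (R : realType) (v : R) : 'cV[R]_3 :=
  \col_i [:: 1; v; v ^+ 2 / 2]`_i.

Definition edot (R : realType) (q : R -> 'cV[R]_3) (x v : R) : R :=
  \sum_(i < 3) evec v i 0 * q x i 0.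

Definition moments (R : realType) (w : R -> R -> R) (x : R) : 'cV[R]_3 :=
  \col_i \int[lebesgue_measure]_(v in setT) (evec v i 0 * w x v).

Definition fluid_vec (R : realType) (n u theta : R) : 'cV[R]_3 :=
  \col_i [:: n; n * u; n * (u ^+ 2 + theta) / 2]`_i.

Definition realizable (R : realType) (eta : 'cV[R]_3) : Prop :=
  exists n u theta : R, [/\ 0 < n, 0 < theta & eta = fluid_vec n u theta].

(* n, u, theta are recovered from eta = (n, n u, n (u^2 + theta) / 2);
   see [MaxwellianE]. *)
Definition Maxwellian (R : realType) (eta : 'cV[R]_3) (v : R) : R :=
  let n := eta 0 0 in
  let u := eta 1 0 / n in
  let theta := 2 * eta 2%:R 0 / n - u ^+ 2 in
  n / Num.sqrt (2 * pi * theta) * expR (- (v - u) ^+ 2 / (2 * theta)).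

Lemma MaxwellianE (R : realType) (n u theta v : R) : 0 < n ->
  Maxwellian (fluid_vec n u theta) v =
  n / Num.sqrt (2 * pi * theta) * expR (- (v - u) ^+ 2 / (2 * theta)).
Proof.
move=> n0; rewrite /Maxwellian !mxE /=.
have n_neq0 : n != 0 by rewrite gt_eqF.
have -> : n * u / n = u by field.
by have -> : 2 * (n * (u ^+ 2 + theta) / 2) / n - u ^+ 2 = theta by field.
Qed.

Definition Mfield (R : realType) (eta : R -> 'cV[R]_3) (x v : R) : R :=
  Maxwellian (eta x) v.

(** Traces *)

Definition traceL (R : realType) (q : R -> R) (xe : R) : R :=
  lim (q y @[y --> xe^'-]).

Definition traceR (R : realType) (q : R -> R) (xe : R) : R :=
  lim (q y @[y --> xe^'+]).

Definition avg (R : realType) (q : R -> R) (xe : R) : R :=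
  (traceR q xe + traceL q xe) / 2.

Definition jump (R : realType) (q : R -> R) (xe : R) : R :=
  traceL q xe - traceR q xe.

Definition realizable_field (R : realType) (a : R) (s : seq R)
    (eta : R -> 'cV[R]_3) : Prop :=
  [/\ forall x, xcells a s x -> realizable (eta x),
      forall xe, xe \in belast a s ->
        realizable (\col_i traceR (fun y => eta y i 0) xe) &
      forall xe, xe \in s ->
        realizable (\col_i traceL (fun y => eta y i 0) xe)].

(** Forms *)

(* The cellwise derivative in x; the nodes, which form a null set, get 0. *)
Definition dxh (R : realType) (a : R) (s : seq R) (z : R -> R -> R) (x v : R)
    : R :=
  if x \in xcells a s then derive1 (z ^~ v) x else 0.

Definition upwind_flux (R : realType) (w : R -> R -> R) (xe v : R) : R :=
  v * avg (w ^~ v) xe + `|v| / 2 * jump (w ^~ v) xe.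

Definition Aform (R : realType) (a b : R) (s : seq R) (w z : R -> R -> R)
    : R :=
  - inner_xv a b (fun x v => v * w x v) (dxh a s z)
  + \sum_(xe <- interior_nodes a s)
      \int[lebesgue_measure]_(v in setT)
         (upwind_flux w xe v * jump (z ^~ v) xe)
  + (\int[lebesgue_measure]_(v in `]-oo, 0[)
        (v * traceR (w ^~ v) a * traceR (z ^~ v) a * (-1))
     + \int[lebesgue_measure]_(v in `]0, +oo[)
        (v * traceL (w ^~ v) b * traceL (z ^~ v) b * 1)).

(* The inflow data fm is a function of (x, v), used at (a, v) for v > 0 and at
   (b, v) for v < 0 only. *)
Definition Bform (R : realType) (a b : R) (fm z : R -> R -> R) : R :=
  \int[lebesgue_measure]_(v in `]0, +oo[)
     (v * fm a v * traceR (z ^~ v) a * (-1))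
  + \int[lebesgue_measure]_(v in `]-oo, 0[)
     (v * fm b v * traceL (z ^~ v) b * 1).

Definition Lform (R : realType) (a b : R) (s : seq R) (nu : R)
    (w z : R -> R -> R) : R :=
  Aform a b s w z + nu * inner_xv a b w z.

Definition Eform (R : realType) (a b : R) (s : seq R)
    (eta q : R -> 'cV[R]_3) : R :=
  Aform a b s (Mfield eta) (edot q).

(* Continuity of the inflow data on Vh, in the sense in which the data enters
   the scheme: convergence of the data is tested against Vhhat. *)
Definition inflow_continuous (R : realType) (a b : R) (s : seq R)
    (kappa : nat) (vmax : R) (Nv : nat)
    (inflow : (R -> R -> R) -> (R -> R -> R)) : Prop :=
  forall (g : nat -> R -> R -> R) (glim : R -> R -> R),
    (forall l, Vh a s kappa vmax Nv (g l)) -> Vh a s kappa vmax Nv glim ->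
    cvg_Vh a b g glim ->
    forall z, Vhhat a s kappa vmax Nv z ->
      Bform a b (inflow (g l)) z @[l --> \oo] --> Bform a b (inflow glim) z.

(* Main.v *)
Require Import Defs.
From mathcomp Require Import all_boot all_order all_algebra.
From mathcomp Require Import all_classical all_reals all_analysis.
From mathcomp Require Import ring lra measurable_realfun.
Import Order.TTheory GRing.Theory Num.Theory.
Import numFieldNormedType.Exports.
Set Implicit Arguments.
Unset Strict Implicit.
Unset Printing Implicit Defensive.
Local Open Scope classical_set_scope.
Local Open Scope ring_scope.

(** For a fixed test function [z], the kinetic equation of step [l] is an
    identity between real numbers, and the claim is its limit as [l] tends to
    infinity.  The inflow term converges by the continuity of the data, and
    consistency turns the Maxwellian of [rhostar] into that of [moments fstar].
    For the other terms, two points need an argument.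

    The convergence of [f l] is in the mean square, whereas the transport form
    contains traces at the nodes of the mesh.  On a fixed cell the values of a
    polynomial of bounded degree are controlled by its mean square
    ([poly_inverse_inequality], [poly_inverse_inequality2]): among separated
    subintervals each holds a point where the square is at most its average,
    and finitely many separated values bound the whole polynomial.  As there are
    finitely many cells, [f l] converges uniformly on all of them
    ([Vh_sup_bound], [Vh_cvg_uniform]), and uniform limits commute with traces.

    The velocity line is unbounded, the test functions grow, and the Maxwellian
    is singular at the boundary of the realizable set.  Density and
    [variance_defect], that is n and n^2 theta, are polynomial in x on each
    cell; realizability of [rhostar], including its one-sided traces, makes them
    positive on the closed cell, hence bounded below
    ([realizable_field_bounds]).  By uniform convergence the fields [rho l]
    obey similar bounds for large l, so that their Maxwellians lie below one
    Gaussian in v ([Maxwellian_le_gauss]).  So do the functions [f l], which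
    vanish for large v.  A Gaussian absorbs the polynomial growth of the test
    functions, and dominated convergence ([gauss_cvg_Rintegral]) gives the limit
    of every integral. *)

(** * Dominated convergence with a Gaussian bound *)

Section GaussianDomination.
Context {d} {T : measurableType d} {R : realType}.
Context (mu : {measure set T -> \bar R}) (D : set T) (V : T -> R) (N : set T).

(** [V] is the velocity coordinate, on the velocity line or on phase space.
    [N] will be a null set carrying the nodes of the meshes, where discrete
    functions are arbitrary.  The bound is only eventual because the fluid
    fields are controlled by their limit for large indices only. *)
Definition gauss_cvg (F : nat -> T -> R) (F0 : T -> R) : Prop :=
  [/\ forall l, measurable_fun D (F l), measurable_fun D F0,
      forall t, D t -> ~ N t -> F l t @[l --> \oo] --> F0 t &
      exists K c : R, 0 < c /\ \forall l \near \oo, forall t, D t -> ~ N t ->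
        `|F l t| <= K * expR (- c * V t ^+ 2)].

Definition poly_growth (z : T -> R) : Prop :=
  exists (C : R) (k : nat), forall t, D t -> `|z t| <= C * (1 + V t ^+ 2) ^+ k.

Lemma poly_growth_ge0 z : poly_growth z ->
  exists2 C : R, 0 <= C & exists k, forall t, D t -> `|z t| <= C * (1 + V t ^+ 2) ^+ k.
Proof.
move=> [C [k h]]; exists `|C| => //; exists k => t Dt.
apply: le_trans (h t Dt) _; rewrite ler_wpM2r ?ler_norm// exprn_ge0//.
by rewrite addr_ge0 ?sqr_ge0.
Qed.

Lemma poly_growthM z1 z2 : poly_growth z1 -> poly_growth z2 -> poly_growth (z1 \* z2).
Proof.
move=> /poly_growth_ge0[C C0 [k h]] /poly_growth_ge0[C' C'0 [k' h']].
exists (C * C'), (k + k')%N => t Dt /=.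
rewrite normrM exprD mulrACA; apply: ler_pM => //; [exact: h|exact: h'].
Qed.

Lemma poly_growthD z1 z2 : poly_growth z1 -> poly_growth z2 -> poly_growth (z1 \+ z2).
Proof.
move=> /poly_growth_ge0[C C0 [k h]] /poly_growth_ge0[C' C'0 [k' h']].
exists (C + C'), (k + k')%N => t Dt /=.
have g1 : 1 <= 1 + V t ^+ 2 by rewrite lerDl sqr_ge0.
apply: le_trans (ler_normD _ _) _; rewrite mulrDl; apply: lerD.
  apply: le_trans (h t Dt) _; rewrite ler_wpM2l// exprD ler_peMr//.
    by rewrite exprn_ge0// (le_trans _ g1).
  exact: exprn_ege1.
apply: le_trans (h' t Dt) _; rewrite ler_wpM2l// exprD ler_peMl//.
  by rewrite exprn_ge0// (le_trans _ g1).
exact: exprn_ege1.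
Qed.

Lemma poly_growth_cst (r : R) : poly_growth (cst r).
Proof. by exists `|r|, 0%N => t _; rewrite expr0 mulr1. Qed.

Lemma poly_growth_sum (I : Type) (r : seq I) (z : I -> T -> R) :
  (forall i, poly_growth (z i)) -> poly_growth (fun t => \sum_(i <- r) z i t).
Proof.
move=> h; elim: r => [|i r IH].
  by apply: (eq_rect _ poly_growth (poly_growth_cst 0)); apply/funext => t; rewrite big_nil.
apply: (eq_rect _ poly_growth (poly_growthD (h i) IH)).
by apply/funext => t /=; rewrite big_cons.
Qed.

Lemma poly_growth_V : poly_growth V.
Proof.
exists 1, 1%N => t _; rewrite mul1r expr1.
have := sqr_ge0 (`|V t| - 1); rewrite sqrrB1 real_normK ?num_real// => h.
by have := normr_ge0 (V t); lra.
Qed.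

Lemma poly_growth_le (g h : T -> R) :
  (forall t, D t -> `|g t| <= h t) -> poly_growth h -> poly_growth g.
Proof.
move=> gh [C [k hk]]; exists C, k => t Dt; apply: le_trans (hk t Dt).
by apply: le_trans (gh t Dt) _; exact: ler_norm.
Qed.

Lemma poly_growth_norm (g : T -> R) :
  poly_growth g -> poly_growth (fun t => `|g t|).
Proof. by move=> [C [k h]]; exists C, k => t Dt; rewrite normr_id; exact: h. Qed.

(** For every e > 0, 1 + y <= (1 + 1/e) (1 + e y) <= (1 + 1/e) exp (e y); the
    k-th power costs half of the exponent when k e <= c / 2. *)
Lemma gauss_absorbs_poly (c : R) (k : nat) : 0 < c ->
  exists2 K : R, 0 <= K & forall y, 0 <= y -> (1 + y) ^+ k * expR (- c * y) <=
    K * expR (- (c / 2) * y).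
Proof.
move=> c0; pose e := c / 2 / k.+1%:R.
have e0 : 0 < e by rewrite !divr_gt0// ltr0n.
have ei0 : 0 < e^-1 by rewrite invr_gt0.
exists ((1 + e^-1) ^+ k); first by rewrite exprn_ge0// addr_ge0// ltW.
move=> y y0.
have h1 : 1 + y <= (1 + e^-1) * expR (e * y).
  apply: (@le_trans _ _ ((1 + e^-1) * (1 + e * y))).
    rewrite mulrDl mul1r mulrDr mulr1 mulrA mulVf ?gt_eqF// mul1r.
    have := mulr_ge0 (ltW e0) y0; lra.
  by rewrite ler_wpM2l ?expR_ge1Dx// addr_ge0// ltW.
have h2 : (1 + y) ^+ k <= (1 + e^-1) ^+ k * expR (c / 2 * y).
  apply: (@le_trans _ _ (((1 + e^-1) * expR (e * y)) ^+ k)).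
    by apply: lerXn2r => //; rewrite nnegrE ?addr_ge0// mulr_ge0 ?expR_ge0// addr_ge0// ltW.
  rewrite exprMn ler_wpM2l ?exprn_ge0// ?addr_ge0// ?(ltW ei0)//.
  rewrite -expRM_natl ler_expR mulrA ler_wpM2r// /e mulrCA ler_piMr//.
    by rewrite divr_ge0// ltW.
  by rewrite ler_pdivrMr ?ltr0n// mul1r ler_nat.
apply: (@le_trans _ _ ((1 + e^-1) ^+ k * expR (c / 2 * y) * expR (- c * y))).
  by rewrite ler_wpM2r ?expR_ge0.
rewrite -mulrA -expRD le_eqVlt; apply/orP; left; apply/eqP; congr (_ * expR _).
by field.
Qed.

Lemma gauss_cvgD F F0 G G0 : gauss_cvg F F0 -> gauss_cvg G G0 ->
  gauss_cvg (fun l => F l \+ G l) (F0 \+ G0).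
Proof.
move=> [mF mF0 FF [K [c [c0 hK]]]] [mG mG0 GG [K' [c' [c'0 hK']]]].
split.
- by move=> l; exact: measurable_funD.
- exact: measurable_funD.
- by move=> t Dt Nt; apply: cvgD; [exact: FF|exact: GG].
exists (`|K| + `|K'|), (Num.min c c'); split; first by rewrite lt_min c0 c'0.
near=> l => t Dt Nt.
have hm (x y : R) : Num.min c c' <= x -> y <= `|y| ->
    y * expR (- x * V t ^+ 2) <= `|y| * expR (- Num.min c c' * V t ^+ 2).
  move=> mx _; apply: (@le_trans _ _ (`|y| * expR (- x * V t ^+ 2))).
    by rewrite ler_wpM2r ?expR_ge0// ler_norm.
  by rewrite ler_wpM2l// ler_expR ler_wpM2r ?sqr_ge0// lerN2.
apply: le_trans (ler_normD _ _) _; rewrite mulrDl; apply: lerD.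
  have h : `|F l t| <= K * expR (- c * V t ^+ 2) by move: t Dt Nt {hm}; near: l.
  by apply: le_trans h (hm _ _ _ (ler_norm _)); rewrite ge_min lexx.
have h : `|G l t| <= K' * expR (- c' * V t ^+ 2) by move: t Dt Nt {hm}; near: l.
by apply: le_trans h (hm _ _ _ (ler_norm _)); rewrite ge_min lexx orbT.
Unshelve. all: by end_near. Qed.

Lemma gauss_cvgM F F0 z : gauss_cvg F F0 -> measurable_fun D z -> poly_growth z ->
  gauss_cvg (fun l => F l \* z) (F0 \* z).
Proof.
move=> [mF mF0 FF [K [c [c0 hK]]]] mz /poly_growth_ge0[C C0 [k hz]].
split.
- by move=> l; exact: measurable_funM.
- exact: measurable_funM.
- by move=> t Dt Nt; apply: cvgMl; exact: FF.
have [K' K'0 hK'] := gauss_absorbs_poly k c0.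
exists (`|K| * C * K'), (c / 2); split; first by rewrite divr_gt0.
near=> l => t Dt Nt /=.
have h : `|F l t| <= K * expR (- c * V t ^+ 2) by move: t Dt Nt; near: l.
rewrite normrM.
apply: (@le_trans _ _ (`|K| * expR (- c * V t ^+ 2) * (C * (1 + V t ^+ 2) ^+ k))).
  apply: ler_pM => //; last exact: hz.
  by apply: le_trans h _; rewrite ler_wpM2r ?expR_ge0// ler_norm.
rewrite mulrACA -!mulrA ler_wpM2l// ler_wpM2l//.
by rewrite [X in X <= _]mulrC; apply: hK'; exact: sqr_ge0.
Unshelve. all: by end_near. Qed.

(** Dominated convergence, after dropping the indices before the bound holds. *)
Lemma gauss_cvg_Rintegral F F0 : measurable D -> mu.-negligible N ->
  (forall c : R, 0 < c -> mu.-integrable D (EFin \o (fun t => expR (- c * V t ^+ 2)))) ->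
  gauss_cvg F F0 ->
  \int[mu]_(t in D) F l t @[l --> \oo] --> \int[mu]_(t in D) F0 t.
Proof.
move=> mD N0 iV [mF mF0 FF [K [c [c0 [L _ hK]]]]].
rewrite -(cvg_shiftn L).
have ig : mu.-integrable D (EFin \o (fun t => K * expR (- c * V t ^+ 2))).
  rewrite (_ : _ \o _ = fun t => (K%:E * (expR (- c * V t ^+ 2))%:E)%E).
    by apply: integrableZl => //; exact: iV.
  by apply/funext => t /=; rewrite EFinM.
have [] := @dominated_convergence _ _ _ mu D mD
  (fun l => EFin \o F (l + L)%N) (EFin \o F0)
  (EFin \o (fun t => K * expR (- c * V t ^+ 2))) _ _ _ ig _.
- by move=> n; apply/measurable_EFinP.
- exact/measurable_EFinP.
- apply: negligibleS N0 => t /= h; apply: contrapT => Nt; apply: h => Dt.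
  apply: cvg_EFin; first exact: nearW.
  by rewrite (cvg_shiftn L (fun l => F l t)); exact: FF.
- apply: negligibleS N0 => t /= h; apply: contrapT => Nt; apply: h => n Dt.
  by rewrite /= lee_fin; apply: hK => //=; rewrite leq_addl.
move=> iF0 _ h.
apply: fine_cvg; rewrite fineK//.
exact: integrable_fin_num.
Unshelve. all: by end_near. Qed.

End GaussianDomination.

Lemma gauss_cvg_sub d (T : measurableType d) (R : realType) (D D' : set T)
  (V : T -> R) (N : set T) F F0 : measurable D -> D' `<=` D ->
  gauss_cvg D V N F F0 -> gauss_cvg D' V N F F0.
Proof.
move=> mD DD [mF mF0 FF [K [c [c0 hK]]]]; split.
- by move=> l; apply: measurable_funS (mF l).
- exact: measurable_funS mF0.
- by move=> t /DD; exact: FF.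
- by exists K, c; split => //; apply: filterS hK => l h t /DD; exact: h.
Qed.

(** Up to a factor this is the normal density of variance 1 / (2 c). *)
Lemma integrable_gauss {R : realType} (c : R) : 0 < c ->
  (@lebesgue_measure R).-integrable setT (EFin \o (fun v : R => expR (- c * v ^+ 2))).
Proof.
move=> c0.
have s0 : 0 < Num.sqrt (2 * c)^-1 by rewrite sqrtr_gt0 invr_gt0 mulr_gt0.
have s0' := lt0r_neq0 s0.
have p0 := normal_peak_gt0 s0'.
have h := @integrable_normal_pdf R 0 (Num.sqrt (2 * c)^-1).
rewrite (_ : _ \o _ = fun v : R => (((normal_peak (Num.sqrt (2 * c)^-1))^-1)%:E *
   (normal_pdf 0 (Num.sqrt (2 * c)^-1) v)%:E)%E); first exact: integrableZl.
apply/funext => v /=; rewrite -EFinM normal_pdfE// mulKf ?gt_eqF//.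
rewrite /normal_fun subr0; congr ((expR _)%:E).
rewrite sqr_sqrtr ?invr_ge0 ?mulr_ge0 ?ltW//.
by field; rewrite gt_eqF.
Qed.

(** * Piecewise polynomials on the spatial mesh *)

Lemma node_cover (R : realDomainType) (p : nat -> R) (n : nat) (x : R) :
  p 0%N < x -> x < p n -> (forall j, (j <= n)%N -> x != p j) ->
  exists2 j, (j < n)%N & p j < x < p j.+1.
Proof.
elim: n => [h0 hn|n IH h0 hn hx]; first by have := lt_trans h0 hn; rewrite ltxx.
have [xn|nx|e] := ltgtP x (p n).
- by have [j jn hj] := IH h0 xn (fun j jn => hx j (leqW jn)); exists j => //; rewrite ltnS ltnW.
- by exists n => //; rewrite nx hn.
- by have := hx n (leqnSn n); rewrite e eqxx.
Qed.

Section PiecewisePoly.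
Context {R : realType}.
Implicit Types (I : nat -> interval R) (g : R -> R) (s : seq R).

Lemma measurable_fun_countable (A : set R) g : countable A -> measurable_fun A g.
Proof.
move=> cA _ Y mY; apply: countable_measurable; first by move=> t; exact: measurable_set1.
by apply: sub_countable cA; apply: subset_card_le => t [].
Qed.

Lemma countable_seq s : countable [set` s].
Proof. by apply: finite_set_countable; exact: finite_seq. Qed.

(** The values of a discrete function at the nodes are arbitrary, but there are
    finitely many nodes. *)
Lemma measurable_off_seq (D : set R) s g : measurable D ->
  measurable_fun (D `\` [set` s]) g -> measurable_fun D g.
Proof.
move=> mD mg.
have ms : measurable [set` s].
  by apply: countable_measurable (countable_seq s) => t; exact: measurable_set1.
have -> : D = (D `\` [set` s]) `|` (D `&` [set` s]).
  by apply/seteqP; split=> [t Dt|t [[]|[]]//]; have [ts|ts] := pselect ([set` s] t); [right|left].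
apply/measurable_funU; [exact: measurableD|exact: measurableI|split=> //].
apply: measurable_fun_countable; apply: sub_countable (countable_seq s).
by apply: subset_card_le => t [].
Qed.

Lemma piecewise_poly_measurable k n I g (D : set R) s : measurable D ->
  (forall t, D t -> t \notin s -> exists2 i, (i < n)%N & t \in I i) ->
  piecewise_poly k n I g -> measurable_fun D g.
Proof.
move=> mD cov pg; apply: (@measurable_off_seq _ s) => //.
have ms : measurable [set` s].
  by apply: countable_measurable (countable_seq s) => t; exact: measurable_set1.
pose E i := if (i < n)%N then (D `\` [set` s]) `&` [set` I i] else set0.
have mE i : measurable (E i).
  by rewrite /E; case: ifP => // _; apply: measurableI; [exact: measurableD|exact: measurable_itv].
have -> : D `\` [set` s] = \bigcup_i E i.
  apply/seteqP; split=> [t [Dt /negP ts]|t [i _]]; last by rewrite /E; case: ifP => // _ [].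
  have [i ilt ti] := cov t Dt ts; exists i => //; rewrite /E ilt; split => //.
  by split => //; exact/negP.
apply/measurable_fun_bigcup => // i; rewrite /E; case: ifP => [ilt|_].
  2: exact: measurable_fun_set0.
have [p [_ hp]] := pg i ilt.
apply: (eq_measurable_fun (horner p)); last exact: measurable_poly.
by move=> t; rewrite inE => -[_ ti]; rewrite hp.
Qed.

Lemma poly_growth_horner (D : set R) (p : {poly R}) : poly_growth D id (horner p).
Proof.
elim/poly_ind: p => [|p c IH].
  apply: (eq_rect _ (poly_growth D id) (poly_growth_cst _ _ 0)).
  by apply/funext => t /=; rewrite horner0.
apply: (eq_rect _ (poly_growth D id)
  (poly_growthD (poly_growthM IH (poly_growth_V D id)) (poly_growth_cst _ _ c))).
by apply/funext => t /=; rewrite hornerMXaddC.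
Qed.

(** On the cells, [g] is bounded by the sum of the absolute values of all its
    polynomial pieces; at the exceptional points, by the sum of its values. *)
Lemma piecewise_poly_growth k n I g (D : set R) s :
  (forall t, D t -> t \notin s -> exists2 i, (i < n)%N & t \in I i) ->
  piecewise_poly k n I g -> poly_growth D id g.
Proof.
move=> cov pg.
have /choice[p hp] : forall i, exists p : {poly R}, (i < n)%N -> {in I i, forall y, g y = p.[y]}.
  by move=> i; have [/pg[p [_ hp]]|] := boolP (i < n)%N; [exists p|exists 0].
apply: (@poly_growth_le _ _ _ _ _ _ (fun t => \sum_(i <- iota 0 n) `|(p i).[t]| +
    \sum_(y <- s) `|g y|)).
  move=> t Dt; have [ts|ts] := boolP (t \in s).
    rewrite (big_rem t)//= addrCA lerDl addr_ge0// sumr_ge0//.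
  have [i ilt ti] := cov t Dt ts.
  have ii : i \in iota 0 n by rewrite mem_iota.
  by rewrite (big_rem i)//= (hp i ilt t ti) -addrA lerDl addr_ge0// sumr_ge0.
apply: poly_growthD; last exact: poly_growth_cst.
by apply: poly_growth_sum => i; apply: poly_growth_norm; exact: poly_growth_horner.
Qed.

Lemma cvg_right_poly (l r : R) (p : {poly R}) g : l < r ->
  {in `]l, r[, forall y, g y = p.[y]} -> g y @[y --> l^'+] --> p.[l].
Proof.
move=> lr gp; have h : p.[y] @[y --> l^'+] --> p.[l].
  by apply: cvg_at_right_filter; exact: continuous_horner.
apply: cvg_trans h; apply: near_eq_cvg; near=> y; rewrite gp// in_itv/=.
by apply/andP; split; near: y; [exact: nbhs_right_gt|exact: nbhs_right_lt].
Unshelve. all: by end_near. Qed.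

Lemma cvg_left_poly (l r : R) (p : {poly R}) g : l < r ->
  {in `]l, r[, forall y, g y = p.[y]} -> g y @[y --> r^'-] --> p.[r].
Proof.
move=> lr gp; have h : p.[y] @[y --> r^'-] --> p.[r].
  by apply: cvg_at_left_filter; exact: continuous_horner.
apply: cvg_trans h; apply: near_eq_cvg; near=> y; rewrite gp// in_itv/=.
by apply/andP; split; near: y; [exact: nbhs_left_gt|exact: nbhs_left_lt].
Unshelve. all: by end_near. Qed.

End PiecewisePoly.

Section Mesh.
Context {R : realType} (a b : R) (s : seq R) (hs : itv_partition a b s).

Lemma xcell_lt i : (i < size s)%N -> nth a (a :: s) i < nth a (a :: s) i.+1.
Proof. by move=> ilt; have [/pathP-/(_ a)/(_ i ilt)] := hs. Qed.

Lemma last_nth_mesh : nth a (a :: s) (size s) = b.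
Proof. by have [_ /eqP <-] := hs; rewrite (last_nth a). Qed.

Lemma xcell_cover x : `]a, b[%classic x -> x \notin s ->
  exists2 i, (i < size s)%N & x \in xcell a s i.
Proof.
rewrite /= in_itv/= => /andP[ax xb] xs.
apply: (@node_cover _ (nth a (a :: s))) => //; first by rewrite last_nth_mesh.
move=> [|j] jn; first by rewrite gt_eqF.
by apply: contra xs => /eqP ->; exact: mem_nth.
Qed.

Lemma xcells_cover x : `]a, b[%classic x -> x \notin s -> xcells a s x.
Proof. by move=> xab xs; have [i ilt xi] := xcell_cover xab xs; exists i. Qed.

Lemma xnode_ge i : (i <= size s)%N -> a <= nth a (a :: s) i.
Proof.
elim: i => // i IH ilt; apply: le_trans (IH (ltnW ilt)) _.
exact/ltW/xcell_lt.
Qed.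

Lemma xnode_le i : (i <= size s)%N -> nth a (a :: s) i <= b.
Proof.
move=> ile; rewrite -(subKn ile); elim: (size s - i)%N => [|k IH].
  by rewrite subn0 last_nth_mesh.
apply: le_trans IH; have [/eqP e|h] := boolP (size s - k == 0)%N.
  by rewrite subnS e.
rewrite subnS -{2}[(size s - k)%N]prednK ?lt0n//; apply/ltW/xcell_lt.
by rewrite -ltnS prednK ?lt0n// ltnS leq_subr.
Qed.

Lemma xcells_sub x : xcells a s x -> `]a, b[%classic x.
Proof.
move=> [i /= ilt]; rewrite /xcell/= !in_itv/= => /andP[h1 h2].
by rewrite (le_lt_trans (xnode_ge (ltnW ilt)) h1) (lt_le_trans h2 (xnode_le ilt)).
Qed.

Lemma Vxh_measurable kappa phi : Vxh a s kappa phi -> measurable_fun `]a, b[ phi.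
Proof.
apply: (@piecewise_poly_measurable _ kappa (size s) (xcell a s) phi _ s) => //.
exact: xcell_cover.
Qed.

Lemma Vxh_bounded kappa phi : Vxh a s kappa phi ->
  exists C : R, forall x, `]a, b[%classic x -> `|phi x| <= C.
Proof.
move=> h; have [C C0 [k hC]] := poly_growth_ge0 (piecewise_poly_growth xcell_cover h).
exists (C * (1 + (`|a| + `|b|) ^+ 2) ^+ k) => x xab; apply: le_trans (hC x xab) _.
move: xab; rewrite /= in_itv/= => /andP[ax xb].
have hx : `|x| <= `|a| + `|b|.
  rewrite ler_norml; have := ler_norm a; have := ler_norm (- a); rewrite normrN.
  have := ler_norm b; have := ler_norm (- b); rewrite normrN.
  by have := normr_ge0 a; have := normr_ge0 b => *; apply/andP; split; lra.
rewrite ler_wpM2l// lerXn2r ?nnegrE ?addr_ge0 ?sqr_ge0// lerD2l.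
by rewrite -(real_normK (num_real x)) lerXn2r ?nnegrE ?addr_ge0.
Qed.

(** The one-sided neighbourhoods behind [traceL] and [traceR] are treated
    together through the properties that they share. *)
Definition trace_filter kappa (F : set_system R) :=
  [/\ ProperFilter F, F (xcells a s) & forall phi, Vxh a s kappa phi -> cvg (phi y @[y --> F])].

Lemma trace_filter_right kappa xe : xe \in belast a s -> trace_filter kappa xe^'+.
Proof.
move=> /(nthP a)[i]; rewrite size_belast => ilt.
have -> : nth a (belast a s) i = nth a (a :: s) i.
  by rewrite [a :: s]lastI nth_rcons size_belast ilt.
move=> <-; have lt := xcell_lt ilt; split.
- exact: at_right_proper_filter.
- near=> y; exists i => //=; rewrite /xcell in_itv/=.
  by apply/andP; split; near: y; [exact: nbhs_right_gt|exact: nbhs_right_lt].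
- move=> phi /(_ i ilt)[p [_ hp]]; apply/cvg_ex; exists p.[nth a (a :: s) i].
  exact: cvg_right_poly lt hp.
Unshelve. all: by end_near. Qed.

Lemma trace_filter_left kappa xe : xe \in s -> trace_filter kappa xe^'-.
Proof.
move=> /(nthP a)[i ilt].
have -> : nth a s i = nth a (a :: s) i.+1 by [].
move=> <-; have lt := xcell_lt ilt; split.
- exact: at_left_proper_filter.
- near=> y; exists i => //=; rewrite /xcell in_itv/=.
  by apply/andP; split; near: y; [exact: nbhs_left_gt|exact: nbhs_left_lt].
- move=> phi /(_ i ilt)[p [_ hp]]; apply/cvg_ex; exists p.[nth a (a :: s) i.+1].
  exact: cvg_left_poly lt hp.
Unshelve. all: by end_near. Qed.

Lemma interior_nodes_belast xe : xe \in interior_nodes a s -> xe \in belast a s.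
Proof. by rewrite /interior_nodes; case: (belast a s) => //= y t h; rewrite inE h orbT. Qed.

Lemma interior_nodes_mesh xe : xe \in interior_nodes a s -> xe \in s.
Proof.
rewrite /interior_nodes; case: s => //= y t h.
by rewrite (mem_belast h).
Qed.

Lemma mesh_left : a < b -> a \in belast a s.
Proof.
case: s hs => [/itv_partition_nil ->|y t _ _]; first by rewrite ltxx.
by rewrite /= inE eqxx.
Qed.

Lemma mesh_right : a < b -> b \in s.
Proof.
move=> ab; have [_ /eqP] := hs; case: s => [/= e|y t /= <-]; first by move: ab; rewrite e ltxx.
exact: mem_last.
Qed.

(** The cellwise derivative acts on the spatial factors of a tensor and maps
    polynomials to polynomials; it therefore stays in the test space, whose
    measurability and growth properties apply to it. *)
Lemma dxh_Vhhat kappa vmax Nv (z : R -> R -> R) :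
  Vhhat a s kappa vmax Nv z -> Vhhat a s kappa vmax Nv (dxh a s z).
Proof.
move=> [m [phi [psi [hphi hpsi zE]]]].
have cellE k i x (p : {poly R}) : x \in xcell a s i ->
    {in xcell a s i, forall y, phi k y = p.[y]} -> is_derive x 1 (phi k) p^`().[x].
  move=> xi hp; have nb : \near x, p.[x] = phi k x.
    have : \near x, x \in xcell a s i by exact: near_in_itvoo.
    by apply: filterS => y /hp.
  have dp := is_derive_poly p x.
  exact: near_eq_is_derive nb dp.
exists m, (fun k x => if x \in xcells a s then derive1 (phi k) x else 0), psi; split => //.
- move=> k i ilt; have [p [sp hp]] := hphi k i ilt.
  exists p^`(); split.
    have [->|p0] := eqVneq p 0; first by rewrite deriv0 size_poly0.
    exact: leq_trans (ltnW (lt_size_deriv p0)) sp.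
  move=> x xi; rewrite mem_set; last by exists i.
  by rewrite derive1E; have /@derive_val := cellE k i x p xi hp.
- move=> x v; rewrite /dxh; case: ifPn => [|_]; last by rewrite big1// => k _; rewrite mul0r.
  rewrite inE => -[i /= ilt xi].
  have -> : z ^~ v = \sum_(k < m) (psi k v *: phi k).
    by apply/funext => y; rewrite zE fct_sumE; apply: eq_bigr => k _; rewrite /= mulrC.
  have dk k : derivable (phi k) x 1.
    have [p [_ hp]] := hphi k i ilt.
    by have /@ex_derive := cellE k i x p xi hp.
  rewrite derive1E derive_sum; last by move=> k; exact: derivableZ.
  by apply: eq_bigr => k _; rewrite deriveZ//= derive1E mulrC.
Qed.

End Mesh.

(** * The velocity mesh *)

Section VelocityMesh.
Context {R : realType} (vmax : R) (Nv : nat).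
Context (vmax_gt0 : 0 < vmax) (Nv_gt0 : (0 < Nv)%N).

Definition vnodes : seq R := [seq vnode vmax Nv j | j <- iota 0 Nv.+1].

Lemma vnode_in j : (j <= Nv)%N -> vnode vmax Nv j \in vnodes.
Proof. by move=> jN; apply: map_f; rewrite mem_iota. Qed.

Lemma vnode0 : vnode vmax Nv 0 = - vmax.
Proof. by rewrite /vnode mulr0 !mul0r addr0. Qed.

Lemma vnodeN : vnode vmax Nv Nv = vmax.
Proof.
have h : Nv%:R != 0 :> R by rewrite pnatr_eq0 -lt0n.
rewrite /vnode; move: h; set N := Nv%:R => h; field; exact: h.
Qed.

Lemma vnode_lt j : vnode vmax Nv j < vnode vmax Nv j.+1.
Proof.
rewrite /vnode ltrD2l ltr_pM2r ?invr_gt0 ?ltr0n//.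
by rewrite ltr_pM2r// ltr_pM2l// ltr_nat.
Qed.

Lemma vcell_cover v : - vmax <= v <= vmax -> v \notin vnodes ->
  exists2 j, (j < Nv)%N & v \in vcell vmax Nv j.
Proof.
move=> /andP[v1 v2] vn; have ne j : (j <= Nv)%N -> v != vnode vmax Nv j.
  by move=> jN; apply: contra vn => /eqP ->; exact: vnode_in.
have [||j jN hj] := @node_cover _ (vnode vmax Nv) Nv v _ _ ne.
- by rewrite lt_neqAle vnode0 v1 -vnode0 eq_sym ne.
- by rewrite lt_neqAle vnodeN v2 -vnodeN ne.
by exists j => //; rewrite /vcell in_itv.
Qed.

(** The outer cells are unbounded and catch the velocities beyond [vmax]. *)
Lemma vhatcell_cover v : v \notin vnodes ->
  exists2 j, (j < Nv)%N & v \in vhatcell vmax Nv j.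
Proof.
move=> vn; have ne j : (j <= Nv)%N -> v != vnode vmax Nv j.
  by move=> jN; apply: contra vn => /eqP ->; exact: vnode_in.
have hE j : v \in vhatcell vmax Nv j = ((j == 0%N) || (vnode vmax Nv j < v)) &&
   ((j.+1 == Nv) || (v < vnode vmax Nv j.+1)).
  by rewrite /vhatcell; case: ifP => _; case: ifP => _; rewrite in_itv/=.
have [vl|vl] := ltP v (- vmax).
  exists 0%N => //; rewrite hE/= (lt_trans vl) ?orbT// -vnode0; exact: vnode_lt.
have [vr|vr] := ltP vmax v.
  exists Nv.-1; rewrite ?prednK// hE !prednK// eqxx andbT (lt_trans _ vr) ?orbT//.
  by have := vnode_lt Nv.-1; rewrite prednK// vnodeN.
have [|j jN] := vcell_cover _ vn; first by rewrite vl vr.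
by rewrite /vcell in_itv/= => /andP[h1 h2]; exists j; rewrite // hE h1 h2 !orbT.
Qed.

Lemma Vvhhat_measurable psi : Vvhhat vmax Nv psi -> measurable_fun setT psi.
Proof.
apply: (@piecewise_poly_measurable _ 2 Nv (vhatcell vmax Nv) psi _ vnodes) => //.
by move=> v _; exact: vhatcell_cover.
Qed.

Lemma Vvhhat_growth psi : Vvhhat vmax Nv psi -> poly_growth setT id psi.
Proof.
apply: (@piecewise_poly_growth _ 2 Nv (vhatcell vmax Nv) psi _ vnodes) => v _.
exact: vhatcell_cover.
Qed.

Lemma Vvh_measurable psi : Vvh vmax Nv psi -> measurable_fun setT psi.
Proof.
move=> [hp h0]; rewrite -(setUv [set` `[- vmax, vmax]]).
have mI : measurable [set` `[- vmax, vmax]] by exact: measurable_itv.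
apply/measurable_funU => //; first exact: measurableC.
split.
  apply: (@piecewise_poly_measurable _ 2 Nv (vcell vmax Nv) psi _ vnodes) => //.
  by move=> v /=; rewrite in_itv/=; exact: vcell_cover.
apply: (@eq_measurable_fun _ _ _ _ _ (cst 0 : R -> R)); last exact: measurable_cst.
by move=> v; rewrite inE => /negP hv; rewrite h0.
Qed.

Lemma negligible_vnodes : (@lebesgue_measure R).-negligible [set` vnodes].
Proof.
apply/negligibleP; last exact: countable_lebesgue_measure0 (countable_seq _).
by apply: countable_measurable (countable_seq _) => t; exact: measurable_set1.
Qed.

Lemma negligible_mesh2 (s r : seq R) :
  ((@lebesgue_measure R) \x (@lebesgue_measure R))%E.-negligible
    [set t : R * R | t.1 \in s \/ t.2 \in r].
Proof.
have ms (u : seq R) : measurable [set` u].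
  by apply: countable_measurable (countable_seq _) => t; exact: measurable_set1.
have z (u : seq R) : (@lebesgue_measure R) [set` u] = 0%E.
  exact: countable_lebesgue_measure0 (countable_seq _).
have -> : [set t : R * R | t.1 \in s \/ t.2 \in r] =
    ([set` s] `*` setT) `|` (setT `*` [set` r]).
  by apply/seteqP; split => -[x v] /=; [case=> h; [left|right]|case=> -[]; [left|right]].
apply: negligibleU; [exists ([set` s] `*` setT)|exists (setT `*` [set` r])]; split => //.
- by apply: measurableX => //; exact: ms.
- apply: eq_trans; first by apply: product_measure1E => //; exact: ms.
  by apply: eq_trans (mul0e _); congr (_ * _)%E; exact: z.
- by apply: measurableX => //; exact: ms.
- apply: eq_trans; first by apply: product_measure1E => //; exact: ms.
  by apply: eq_trans (mule0 _); congr (_ * _)%E; exact: z.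
Qed.

(** By Tonelli, the integral is the length of ]a, b[ times a Gaussian
    integral. *)
Lemma integrable_gauss_strip (a b c : R) : 0 < c ->
  ((@lebesgue_measure R) \x (@lebesgue_measure R))%E.-integrable (`]a, b[ `*` setT)
    (EFin \o (fun t : R * R => expR (- c * t.2 ^+ 2))).
Proof.
move=> c0.
have mg : measurable_fun [set: R] (fun v : R => expR (- c * v ^+ 2)).
  apply: measurableT_comp; first exact: measurable_expR.
  by apply: measurable_funM => //; exact: measurable_funX.
have mD : measurable (`]a, b[ `*` setT : set (R * R)) by exact: measurableX.
have mf : measurable_fun setT (fun t : R * R => (\1_`]a, b[ t.1 * expR (- c * t.2 ^+ 2))%:E).
  apply/measurable_EFinP; apply: measurable_funM.
    by apply: measurableT_comp measurable_fst; exact: measurable_indic.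
  exact: measurableT_comp mg measurable_snd.
apply/integrable_mkcond => //.
rewrite (_ : _ \_ _ = (fun t : R * R => (\1_`]a, b[ t.1 * expR (- c * t.2 ^+ 2))%:E)); last first.
  apply/funext => -[x v] /=; rewrite patchE indicE in_setX/= in_setT andbT.
  by case: (x \in _) => /=; rewrite ?mul1r ?mul0r.
apply/integrableP; split=> //.
rewrite fubini_tonelli1//; last first.
  exact: measurableT_comp.
have ig := integrable_gauss c0.
set G := (\int[(@lebesgue_measure R)]_v (expR (- c * v ^+ 2))%:E)%E.
have Gfin : G \is a fin_num by exact: integrable_fin_num.
have slice (x : R) : (\int[(@lebesgue_measure R)]_v `|(\1_`]a, b[ x * expR (- c * v ^+ 2))%:E| =
    G * (\1_`]a, b[ x)%:E)%E.
  rewrite muleC -ge0_integralZl//.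
  - by apply: eq_integral => v _; rewrite /= ger0_norm ?mulr_ge0 ?expR_ge0// EFinM.
  - exact/measurable_EFinP.
apply: (@le_lt_trans _ _ (\int[(@lebesgue_measure R)]_x (G * (\1_`]a, b[ x)%:E))%E).
  by rewrite le_eqVlt; apply/orP; left; apply/eqP; apply: eq_integral => x _; exact: slice.
rewrite -(fineK Gfin); apply: integrable_lty => //.
by apply: integrableZl => //; exact: integrable_indic_itv.
Qed.

End VelocityMesh.

(** * Inverse inequalities *)

Section InverseInequality.
Context {R : realType}.
Notation mu := (@lebesgue_measure R).

(** Induction on the degree: q = (p - p(z)) / (X - z), with z the last node, has
    smaller degree and is at most 2 B / L at the other nodes. *)
Lemma poly_bounded_by_nodes (n : nat) (L W : R) : 0 < L -> 0 <= W ->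
  exists2 K : R, 0 < K & forall (p : {poly R}) (x : nat -> R) (B t : R),
    (size p <= n.+1)%N ->
    (forall i j, (i < j <= n)%N -> L <= `|x i - x j|) ->
    (forall i, (i <= n)%N -> `|p.[x i]| <= B) ->
    (forall i, (i <= n)%N -> `|t - x i| <= W) -> `|p.[t]| <= B * K.
Proof.
move=> L0 W0; elim: n => [|n [K K0 IH]].
  exists 1 => // p x B t sp _ hB _; rewrite mulr1.
  have := hB 0%N (leqnn _).
  by rewrite (size1_polyC sp) !hornerC.
exists (1 + W * (2 * K / L)); first by rewrite ltr_pwDl// mulr_ge0// divr_ge0 ?mulr_ge0// ltW.
move=> p x B t sp sep hB hW; set z := x n.+1.
have B0 : 0 <= B by apply: le_trans (hB 0%N _).
have : root (p - p.[z]%:P) z by rewrite rootE !hornerE subrr.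
move=> /factor_theorem[q qE].
have pE : p = q * ('X - z%:P) + p.[z]%:P by rewrite -qE subrK.
have sq : (size q <= n.+1)%N.
  have [->|q0] := eqVneq q 0; first by rewrite size_poly0.
  have : (size (q * ('X - z%:P))%R <= n.+2)%N.
    rewrite -qE (leq_trans (size_polyD _ _))// geq_max sp size_polyN.
    by rewrite (leq_trans (size_polyC_leq1 _)).
  by rewrite size_Mmonic ?monicXsubC// size_XsubC addn2.
have hq i : (i <= n)%N -> `|q.[x i]| <= 2 * B / L.
  move=> iln; rewrite ler_pdivlMr//.
  have h1 : L <= `|x i - z| by apply: sep; rewrite ltnS iln/=.
  have e : q.[x i] * (x i - z) = p.[x i] - p.[z].
    by have /(congr1 (horner^~ (x i))) := qE; rewrite !hornerE.
  apply: (@le_trans _ _ (`|q.[x i]| * `|x i - z|)); first by rewrite ler_wpM2l.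
  rewrite -normrM e; apply: le_trans (ler_normB _ _) _.
  by rewrite mulrDl !mul1r lerD ?hB// leqW.
have hqt : `|q.[t]| <= 2 * B / L * K.
  apply: (IH q x _ t sq) => [i j /andP[ij jn]|i iln|i iln]; [|exact: hq|].
    by apply: sep; rewrite ij leqW.
  by apply: hW; exact: leqW.
have ptE : p.[t] = q.[t] * (t - z) + p.[z] by rewrite {1}pE !hornerE.
rewrite ptE; apply: le_trans (ler_normD _ _) _.
rewrite (_ : B * _ = 2 * B / L * K * W + B); last by field; rewrite gt_eqF.
rewrite lerD ?hB// normrM.
by apply: ler_pM => //; exact: hW.
Qed.

(** The point [y] minimizes p^2 on [c, c + h]. *)
Lemma le_average_on_itv (p : {poly R}) (c h : R) (A : set R) : 0 < h -> measurable A ->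
  `[c, c + h] `<=` A ->
  exists2 y, c <= y <= c + h &
    ((h * p.[y] ^+ 2)%:E <= \int[mu]_(x in A) (p.[x] ^+ 2)%:E)%E.
Proof.
move=> h0 mA JA.
have cp : continuous (fun x => p.[x] ^+ 2).
  move=> x; apply: (@continuous_comp _ _ _ (horner p) (fun y => y ^+ 2)).
    exact: continuous_horner.
  exact: exprn_continuous.
have [|y yJ ymin] := @EVT_min R _ c (c + h) _ (continuous_subspaceT cp).
  by rewrite lerDl ltW.
exists y; first by move: yJ; rewrite in_itv.
have mp B : measurable_fun B (fun x => (p.[x] ^+ 2)%:E).
  by apply/measurable_EFinP; apply: measurable_funX; exact: measurable_poly.
apply: (@le_trans _ _ (\int[mu]_(x in `[c, (c + h)%R]) (p.[x] ^+ 2)%:E)%E); last first.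
  apply: ge0_subset_integral; [exact: measurable_itv|exact: mA|exact: mp| |exact: JA].
  by move=> x _; rewrite lee_fin sqr_ge0.
apply: (@le_trans _ _ (\int[mu]_(x in `[c, (c + h)%R]) (p.[y] ^+ 2)%:E)%E); last first.
  apply: ge0_le_integral => //.
  - by move=> x _; rewrite lee_fin sqr_ge0.
  - exact: mp.
have mJ : mu `[c, (c + h)] = h%:E.
  by rewrite lebesgue_measure_itv/= lte_fin ltrDl h0 -EFinB addrAC subrr add0r.
rewrite integral_cst//.
rewrite [X in (_ <= _ * X)%E](_ : _ = h%:E); last exact: mJ.
by rewrite -EFinM mulrC.
Qed.

(** Cut the interval into 2 n + 3 pieces of equal length h and keep every second
    interior one: this gives n + 1 pieces at mutual distance at least h.  Each of
    them has a point where h p^2 is at most the integral of p^2, and the values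
    at these n + 1 points bound p. *)
Lemma poly_inverse_inequality (n : nat) (l r : R) : l < r ->
  exists2 C : R, 0 < C & forall (p : {poly R}) (t : R),
    (size p <= n.+1)%N -> l < t < r ->
    ((p.[t] ^+ 2)%:E <= C%:E * \int[mu]_(x in `]l, r[) (p.[x] ^+ 2)%:E)%E.
Proof.
move=> lr; pose h := (r - l) / (2 * n + 3)%:R.
have n0 : 0 < (2 * n + 3)%:R :> R by rewrite ltr0n addn3.
have h0 : 0 < h by rewrite divr_gt0// subr_gt0.
have hE : h * (2 * n + 3)%:R = r - l by rewrite divfK// gt_eqF.
have [K K0 hK] := @poly_bounded_by_nodes n h (r - l) h0 (ltW (etrans (subr_gt0 _ _) lr)).
exists (K ^+ 2 / h); first by rewrite divr_gt0// exprn_gt0.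
move=> p t sp /andP[lt tr].
set A := (\int[mu]_(x in _) _)%E.
have A0 : (0 <= A)%E by apply: integral_ge0 => x _; rewrite lee_fin sqr_ge0.
have [Ay|Afin] := eqVneq A +oo%E.
  by rewrite Ay gt0_muley ?leey// lte_fin divr_gt0// exprn_gt0.
have {}Afin : A \is a fin_num by rewrite ge0_fin_numE// ltey.
pose c (i : nat) := l + h * (2 * i + 1)%:R.
have cr i : (i <= n)%N -> c i + h < r.
  move=> iln; have : h * (2 * i + 2)%:R < h * (2 * n + 3)%:R.
    by rewrite ltr_pM2l// ltr_nat -addn1 -addnA leq_add2r leq_mul2l.
  by rewrite hE /c !natrD !mulrDr mulr1; lra.
have cl i : l < c i by rewrite /c ltrDl mulr_gt0// ltr0n addn1.
have /choice[y hy] : forall i, exists y, (i <= n)%N -> c i <= y <= c i + h /\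
    ((h * p.[y] ^+ 2)%:E <= A)%E.
  move=> i; have [iln|] := boolP (i <= n)%N; last by exists 0.
  have [|y y1 y2] := @le_average_on_itv p (c i) h `]l, r[ h0 (measurable_itv _).
    move=> z; rewrite /= !in_itv/= => /andP[z1 z2].
    by rewrite (lt_le_trans (cl i) z1) (le_lt_trans z2 (cr i iln)).
  by exists y.
have B0 : 0 <= fine A / h by rewrite divr_ge0 ?fine_ge0// ltW.
have := hK p y (Num.sqrt (fine A / h)) t sp.
move=> /(_ _ _ _) hh.
have {}hh : `|p.[t]| <= Num.sqrt (fine A / h) * K.
  apply: hh.
  - move=> i j /andP[ij jn].
    have [/andP[yi1 yi2] _] := hy i (leq_trans (ltnW ij) jn).
    have [/andP[yj1 yj2] _] := hy j jn.
    rewrite distrC (le_trans _ (ler_norm _))//.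
    have : h * (2 * i + 3)%:R <= h * (2 * j + 1)%:R.
      rewrite ler_pM2l// ler_nat -[3%N]/(2 * 1 + 1)%N addnA leq_add2r.
      by rewrite -mulnDr leq_mul2l addn1.
    move: yi2 yj1; rewrite /c !natrD !mulrDr.
    by move=> *; lra.
  - move=> i iln; have [_] := hy i iln.
    rewrite -(fineK Afin) lee_fin => hi.
    rewrite -sqrtr_sqr ler_wsqrtr// ler_pdivlMr//.
    by rewrite mulrC.
  - move=> i iln; have [/andP[y1 y2] _] := hy i iln.
    have := cl i; have := cr i iln => *.
    by rewrite ler_norml; apply/andP; split; lra.
rewrite -(fineK Afin) -EFinM lee_fin.
rewrite -(real_normK (num_real _)).
apply: (@le_trans _ _ ((Num.sqrt (fine A / h) * K) ^+ 2)).
  by rewrite lerXn2r ?nnegrE// mulr_ge0// ltW.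
by rewrite exprMn sqr_sqrtr// le_eqVlt; apply/orP; left; apply/eqP; ring.
Qed.

(** The one-dimensional inequality is applied in v at fixed x, then in x under
    the integral over v; Tonelli identifies the iterated integral. *)
Lemma poly_inverse_inequality2 (n m : nat) (l r l' r' : R) : l < r -> l' < r' ->
  exists2 C : R, 0 < C & forall (w : R -> R -> R),
    measurable_fun (`]l, r[ `*` `]l', r'[) (fun t : R * R => w t.1 t.2) ->
    (forall v, v \in `]l', r'[ -> exists p : {poly R}, (size p <= n.+1)%N /\
       {in `]l, r[, forall x, w x v = p.[x]}) ->
    (forall x, x \in `]l, r[ -> exists p : {poly R}, (size p <= m.+1)%N /\
       {in `]l', r'[, forall v, w x v = p.[v]}) ->
    forall x v, x \in `]l, r[ -> v \in `]l', r'[ ->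
    ((w x v ^+ 2)%:E <=
      C%:E * \int[mu \x mu]_(t in `]l, r[ `*` `]l', r'[) (w t.1 t.2 ^+ 2)%:E)%E.
Proof.
move=> lr lr'.
have [C C0 hC] := poly_inverse_inequality n lr.
have [C' C'0 hC'] := poly_inverse_inequality m lr'.
exists (C' * C); first exact: mulr_gt0.
move=> w mw wx wv x v xI vJ.
pose I := [set` `]l, r[]; pose J := [set` `]l', r'[].
have mJ : measurable J by exact: measurable_itv.
have mIJ : measurable (I `*` J : set (R * R)) by apply: measurableX; exact: measurable_itv.
pose h := ((fun t : R * R => (w t.1 t.2 ^+ 2)%:E) \_ (I `*` J)).
have h0 t : (0 <= h t)%E.
  by rewrite /h patchE; case: ifP => _ //; rewrite lee_fin sqr_ge0.
have mh : measurable_fun setT h.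
  have mw2 : measurable_fun (I `*` J) (fun t : R * R => (w t.1 t.2 ^+ 2)%:E).
    by apply/measurable_EFinP; exact: measurable_funX.
  exact: (measurable_restrictT _ mIJ).1 mw2.
have -> : (\int[mu \x mu]_(t in `]l, r[ `*` `]l', r'[) (w t.1 t.2 ^+ 2)%:E =
   \int[mu]_v \int[mu]_x h (x, v))%E.
  by rewrite integral_mkcond; exact: (@fubini_tonelli2 _ _ _ _ R mu mu h mh h0).
have mG : measurable_fun setT (fun v => \int[mu]_x h (x, v))%E.
  exact: (@measurable_fun_fubini_tonelli_G _ _ _ _ R mu h mh h0).
have G0 v' : (0 <= \int[mu]_x h (x, v'))%E by exact: integral_ge0.
have GE v' : v' \in `]l', r'[ ->
    (\int[mu]_x h (x, v') = \int[mu]_(x in I) (w x v' ^+ 2)%:E)%E.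
  move=> v'J; rewrite [RHS]integral_mkcond; apply: eq_integral => x' _.
  rewrite /h !patchE in_setX/= (_ : (v' \in J) = true) ?andbT//.
  exact/mem_set.
have [q [sq hq]] := wv x xI.
apply: (@le_trans _ _ (C'%:E * \int[mu]_(v' in J) (w x v' ^+ 2)%:E)%E).
  have -> : (\int[mu]_(v' in J) (w x v' ^+ 2)%:E = \int[mu]_(v' in J) (q.[v'] ^+ 2)%:E)%E.
    by apply: eq_integral => v'; rewrite inE => /hq ->.
  by rewrite hq//; apply: hC' => //; move: vJ; rewrite in_itv.
rewrite EFinM -muleA; apply: lee_wpmul2l; first by rewrite lee_fin ltW.
apply: (@le_trans _ _ (\int[mu]_(v' in J) (C%:E * \int[mu]_x h (x, v')))%E); last first.
  rewrite ge0_integralZl//; last 2 first.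
  - exact: measurable_funTS.
  - by rewrite lee_fin ltW.
  apply: lee_wpmul2l; first by rewrite lee_fin ltW.
  by apply: ge0_subset_integral.
apply: ge0_le_integral => //.
- by move=> v' _; rewrite lee_fin sqr_ge0.
- apply: (eq_measurable_fun (fun v' => (q.[v'] ^+ 2)%:E)).
    by move=> v'; rewrite inE => /hq ->.
  by apply/measurable_EFinP; apply: measurable_funX; exact: measurable_poly.
- by apply: measurable_funeM; exact: measurable_funTS.
move=> v' v'J; rewrite GE//.
have [p [sp hp]] := wx v' v'J.
have -> : (\int[mu]_(x in I) (w x v' ^+ 2)%:E = \int[mu]_(x in I) (p.[x] ^+ 2)%:E)%E.
  by apply: eq_integral => x'; rewrite inE => /hp ->.
by rewrite hp//; apply: hC => //; move: xI; rewrite in_itv.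
Qed.

End InverseInequality.

(** * Discrete phase-space functions *)

Section TensorSpaces.
Context {R : realType}.
Notation mu := (@lebesgue_measure R).
Implicit Types (A B : set (R -> R)) (w : R -> R -> R).

Lemma tensor_measurable A B w (I : set R) : measurable I ->
  (forall phi, A phi -> measurable_fun I phi) ->
  (forall psi, B psi -> measurable_fun setT psi) -> tensor A B w ->
  measurable_fun (I `*` setT) (fun t : R * R => w t.1 t.2).
Proof.
move=> mI mA mB [m [phi [psi [hphi hpsi wE]]]].
under eq_fun do rewrite wE.
apply: measurable_sum => k; apply: measurable_funM.
  apply: (@measurable_comp _ _ _ _ _ _ I (phi k)) => //.
  - by move=> _ [t [It _] <-].
  - exact: mA.
  - by apply: measurable_funTS; exact: measurable_fst.
apply: measurableT_comp; first exact: mB.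
by apply: measurable_funTS; exact: measurable_snd.
Qed.

Lemma tensor_poly_x d n (I : nat -> interval R) B w i v : (i < n)%N ->
  tensor (piecewise_poly d n I) B w ->
  exists p : {poly R}, (size p <= d.+1)%N /\ {in I i, forall x, w x v = p.[x]}.
Proof.
move=> ilt [m [phi [psi [hphi hpsi wE]]]].
have /choice[p hp] : forall k, exists p : {poly R}, (size p <= d.+1)%N /\
  {in I i, forall x, phi k x = p.[x]} by move=> k; exact: hphi.
exists (\sum_(k < m) psi k v *: p k); split.
  apply: leq_trans (size_sum _ _ _) _; apply/bigmax_leqP => k _.
  by apply: leq_trans (size_scale_leq _ _) _; case: (hp k).
move=> x xi; rewrite wE horner_sum; apply: eq_bigr => k _.
by rewrite hornerZ mulrC; case: (hp k) => _ ->.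
Qed.

Lemma tensor_poly_v d n (I : nat -> interval R) A B w i x : (i < n)%N ->
  B `<=` piecewise_poly d n I -> tensor A B w ->
  exists p : {poly R}, (size p <= d.+1)%N /\ {in I i, forall v, w x v = p.[v]}.
Proof.
move=> ilt BI [m [phi [psi [hphi hpsi wE]]]].
have /choice[p hp] : forall k, exists p : {poly R}, (size p <= d.+1)%N /\
  {in I i, forall v, psi k v = p.[v]} by move=> k; exact: (BI _ (hpsi k)).
exists (\sum_(k < m) phi k x *: p k); split.
  apply: leq_trans (size_sum _ _ _) _; apply/bigmax_leqP => k _.
  by apply: leq_trans (size_scale_leq _ _) _; case: (hp k).
move=> v vi; rewrite wE horner_sum; apply: eq_bigr => k _.
by rewrite hornerZ; case: (hp k) => _ ->.
Qed.

Lemma cvg_lincomb (F : set_system R) {FF : Filter F} m (phi : 'I_m -> R -> R) (c l : 'I_m -> R) :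
  (forall k, phi k y @[y --> F] --> l k) ->
  \sum_(k < m) phi k y * c k @[y --> F] --> \sum_(k < m) l k * c k.
Proof.
move=> h; rewrite (_ : (fun y => \sum_(k < m) _) =
    \sum_(k < m) (fun y => phi k y * c k)); last first.
  by apply/funext => y; rewrite fct_sumE.
elim/big_ind2: _ => [|f1 l1 f2 l2|k _].
- exact: cvg_cst.
- exact: cvgD.
- by apply: cvgMl; exact: h.
Qed.

End TensorSpaces.

Section DiscreteSpaces.
Context {R : realType} (a b : R) (s : seq R) (hs : itv_partition a b s) (kappa : nat).
Context (vmax : R) (Nv : nat) (vmax_gt0 : 0 < vmax) (Nv_gt0 : (0 < Nv)%N).
Notation mu := (@lebesgue_measure R).
Notation strip := (`]a, b[ `*` [set: R]).

(** The factor exp (vmax^2) compensates the Gaussian on [- vmax, vmax]. *)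
Lemma Vvh_gauss psi : Vvh vmax Nv psi ->
  exists2 K : R, 0 <= K & forall v, `|psi v| <= K * expR (- 1 * v ^+ 2).
Proof.
move=> [hp h0].
have cov v : [set` `[- vmax, vmax]] v -> v \notin vnodes vmax Nv ->
    exists2 j, (j < Nv)%N & v \in vcell vmax Nv j.
  by rewrite /= in_itv/=; exact: vcell_cover.
have [C C0 [k hC]] := poly_growth_ge0 (piecewise_poly_growth cov hp).
have K0 : 0 <= C * (1 + vmax ^+ 2) ^+ k * expR (vmax ^+ 2).
  by rewrite mulr_ge0 ?expR_ge0// mulr_ge0// exprn_ge0// addr_ge0// sqr_ge0.
exists (C * (1 + vmax ^+ 2) ^+ k * expR (vmax ^+ 2)) => // v.
have [vI|vI] := boolP (v \in `[- vmax, vmax]); last first.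
  by rewrite h0// normr0 mulr_ge0// expR_ge0.
have v2 : v ^+ 2 <= vmax ^+ 2.
  rewrite -(real_normK (num_real v)) lerXn2r ?nnegrE ?(ltW vmax_gt0)//.
  by move: vI; rewrite in_itv/= ler_norml.
apply: le_trans (hC v vI) _; rewrite -mulrA -expRD.
apply: (@le_trans _ _ (C * (1 + vmax ^+ 2) ^+ k)).
  by rewrite ler_wpM2l// lerXn2r ?nnegrE ?addr_ge0 ?sqr_ge0// lerD2l.
rewrite -[X in X <= _]mulr1 ler_wpM2l//.
  by rewrite mulr_ge0// exprn_ge0// addr_ge0// sqr_ge0.
by rewrite -[X in X <= _]expR0 ler_expR mulNr mul1r subr_ge0.
Qed.

Lemma Vh_measurable f : Vh a s kappa vmax Nv f ->
  measurable_fun strip (fun t : R * R => f t.1 t.2).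
Proof.
apply: tensor_measurable => //; first by move=> phi; exact: Vxh_measurable.
by move=> psi; exact: Vvh_measurable.
Qed.

Lemma Vhhat_measurable z : Vhhat a s kappa vmax Nv z ->
  measurable_fun strip (fun t : R * R => z t.1 t.2).
Proof.
apply: tensor_measurable => //; first by move=> phi; exact: Vxh_measurable.
by move=> psi; exact: Vvhhat_measurable.
Qed.

Lemma Vhhat_growth z : Vhhat a s kappa vmax Nv z ->
  poly_growth strip snd (fun t : R * R => z t.1 t.2).
Proof.
move=> [m [phi [psi [hphi hpsi zE]]]].
rewrite (_ : (fun t : R * R => z t.1 t.2) =
   fun t => \sum_(k <- index_enum 'I_m) (phi k t.1 * psi k t.2)).
  2: by apply/funext => t; rewrite zE.
apply: poly_growth_sum => k.
have [C hC] := Vxh_bounded hs (hphi k).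
have [C' [j hC']] := Vvhhat_growth vmax_gt0 Nv_gt0 (hpsi k).
apply: (@poly_growthM _ _ _ strip snd (fun t => phi k t.1) (fun t => psi k t.2)).
  by exists C, 0%N => -[x v] [/= xab _]; rewrite expr0 mulr1; exact: hC.
by exists C', j => -[x v] _ /=; exact: hC'.
Qed.

Lemma Vh_gauss f : Vh a s kappa vmax Nv f ->
  exists2 K : R, 0 <= K & forall x v, `]a, b[%classic x ->
    `|f x v| <= K * expR (- 1 * v ^+ 2).
Proof.
move=> [m [phi [psi [hphi hpsi fE]]]].
have /choice[C hC] : forall k, exists C : R, forall x, `]a, b[%classic x -> `|phi k x| <= C.
  by move=> k; have [C hC] := Vxh_bounded hs (hphi k); exists C => x; exact: hC.
have /choice[K hK] : forall k, exists K : R, 0 <= K /\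
    forall v, `|psi k v| <= K * expR (- 1 * v ^+ 2).
  by move=> k; have [K K0 hK] := Vvh_gauss (hpsi k); exists K.
exists (\sum_(k < m) `|C k| * K k).
  by apply: sumr_ge0 => k _; rewrite mulr_ge0//; case: (hK k).
move=> x v xab; rewrite fE mulr_suml; apply: le_trans (ler_norm_sum _ _ _) _.
apply: ler_sum => k _; rewrite normrM -mulrA; have [K0 hKk] := hK k.
by apply: ler_pM => //; apply: le_trans (hC k x xab) (ler_norm _).
Qed.

Lemma Vh_support f x v : Vh a s kappa vmax Nv f -> v \notin `[- vmax, vmax] -> f x v = 0.
Proof.
move=> [m [phi [psi [hphi hpsi fE]]]] vn; rewrite fE big1// => k _.
by case: (hpsi k) => _ ->; rewrite ?mulr0.
Qed.

Lemma inner_xv_ge0 w : 0 <= inner_xv a b w w.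
Proof. by apply: Rintegral_ge0 => t _; rewrite -expr2 sqr_ge0. Qed.

Lemma integral_sqr_Vh g1 g2 : Vh a s kappa vmax Nv g1 -> Vh a s kappa vmax Nv g2 ->
  (\int[mu \x mu]_(t in strip) ((g1 t.1 t.2 - g2 t.1 t.2) ^+ 2)%:E)%E =
  (inner_xv a b (g1 \- g2) (g1 \- g2))%:E.
Proof.
move=> h1 h2; rewrite /inner_xv /Rintegral.
have E : (\int[mu \x mu]_(t in strip) (((g1 \- g2) t.1 t.2 * (g1 \- g2) t.1 t.2)%:E) =
   \int[mu \x mu]_(t in strip) ((g1 t.1 t.2 - g2 t.1 t.2) ^+ 2)%:E)%E.
  by apply: eq_integral => t _; rewrite expr2.
have mD : measurable (strip : set (R * R)) by exact: measurableX.
have [K1 K10 hK1] := Vh_gauss h1.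
have [K2 K20 hK2] := Vh_gauss h2.
rewrite -E fineK// E; apply: integrable_fin_num => //.
have ig : (mu \x mu)%E.-integrable strip
    (fun t : R * R => (((K1 + K2) ^+ 2)%:E * (expR (- 2 * t.2 ^+ 2))%:E)%E).
  by apply: integrableZl => //; exact: integrable_gauss_strip.
apply: le_integrable ig => //.
- apply/measurable_EFinP; apply: measurable_funX; apply: measurable_funB; exact: Vh_measurable.
- move=> [x v] [/= xab _]; rewrite /= lee_fin.
  rewrite normrX [leRHS]ger0_norm; last first.
    by rewrite mulr_ge0 ?expR_ge0// sqr_ge0.
  have -> : expR (- 2 * v ^+ 2) = expR (- 1 * v ^+ 2) ^+ 2.
    by rewrite -expRM_natl; congr expR; ring.
  rewrite -exprMn lerXn2r ?nnegrE ?mulr_ge0 ?addr_ge0 ?expR_ge0//.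
  by apply: le_trans (ler_normB _ _) _; rewrite mulrDl lerD ?hK1 ?hK2.
Qed.

(** On a product of cells this is [poly_inverse_inequality2]; the sum of the
    constants of all products serves for all of them.  Beyond [vmax] both
    functions vanish. *)
Lemma Vh_sup_bound : exists2 C : R, 0 < C & forall g1 g2,
  Vh a s kappa vmax Nv g1 -> Vh a s kappa vmax Nv g2 ->
  forall x v, xcells a s x -> v \notin vnodes vmax Nv ->
  (g1 x v - g2 x v) ^+ 2 <= C * inner_xv a b (g1 \- g2) (g1 \- g2).
Proof.
have /choice[C hC] : forall ij : nat * nat, exists C : R,
    (ij.1 < size s)%N -> (ij.2 < Nv)%N ->
    0 < C /\ forall g1 g2, Vh a s kappa vmax Nv g1 -> Vh a s kappa vmax Nv g2 ->
    forall x v, x \in xcell a s ij.1 -> v \in vcell vmax Nv ij.2 ->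
    (g1 x v - g2 x v) ^+ 2 <= C * inner_xv a b (g1 \- g2) (g1 \- g2).
  move=> [i j] /=.
  have [ilt|] := boolP (i < size s)%N; last by exists 0.
  have [jlt|] := boolP (j < Nv)%N; last by exists 0.
  have [C C0 hC] := poly_inverse_inequality2 kappa 2 (xcell_lt hs ilt)
    (vnode_lt vmax_gt0 Nv_gt0 j).
  exists C => _ _; split=> // g1 g2 h1 h2 x v xi vj.
  have mD : measurable (strip : set (R * R)) by exact: measurableX.
  have mD' : measurable ([set` xcell a s i] `*` [set` vcell vmax Nv j] : set (R * R)).
    by apply: measurableX; exact: measurable_itv.
  have sub : [set` xcell a s i] `*` [set` vcell vmax Nv j] `<=` strip.
    by move=> [x' v'] [/= x'i v'j]; split=> //; apply: (xcells_sub hs); exists i.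
  have m12 : measurable_fun strip (fun t : R * R => g1 t.1 t.2 - g2 t.1 t.2).
    by apply: measurable_funB; exact: Vh_measurable.
  have := hC (fun x v => g1 x v - g2 x v) _ _ _ x v xi vj.
  move=> /(_ _ _ _) hh; rewrite -lee_fin [leRHS]EFinM -(integral_sqr_Vh h1 h2).
  apply: le_trans (hh _ _ _) _.
  - exact: measurable_funS sub m12.
  - move=> v' _.
    have [p1 [s1 e1]] := tensor_poly_x v' ilt h1.
    have [p2 [s2 e2]] := tensor_poly_x v' ilt h2.
    exists (p1 - p2); split; first by rewrite (leq_trans (size_polyD _ _))// size_polyN geq_max s1.
    by move=> x' x'i; rewrite e1// e2// !hornerE.
  - move=> x' _.
    have sV : Vvh vmax Nv `<=` piecewise_poly 2 Nv (vcell vmax Nv) by move=> psi [].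
    have [p1 [s1 e1]] := tensor_poly_v x' jlt sV h1.
    have [p2 [s2 e2]] := tensor_poly_v x' jlt sV h2.
    exists (p1 - p2); split; first by rewrite (leq_trans (size_polyD _ _))// size_polyN geq_max s1.
    by move=> v' v'j; rewrite e1// e2// !hornerE.
  apply: lee_wpmul2l; first by rewrite lee_fin ltW.
  apply: ge0_subset_integral => //.
  - by apply/measurable_EFinP; exact: measurable_funX.
  - by move=> t _; rewrite lee_fin sqr_ge0.
exists (1 + \sum_(i < size s) \sum_(j < Nv) C (nat_of_ord i, nat_of_ord j)).
  rewrite ltr_pwDl//; apply: sumr_ge0 => i _; apply: sumr_ge0 => j _.
  by case: (hC (nat_of_ord i, nat_of_ord j) (ltn_ord i) (ltn_ord j)) => /ltW.
have C0 (i : 'I_(size s)) (j : 'I_Nv) : 0 <= C (nat_of_ord i, nat_of_ord j).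
  by case: (hC (nat_of_ord i, nat_of_ord j) (ltn_ord i) (ltn_ord j)) => /ltW.
move=> g1 g2 h1 h2 x v [i /= ilt xi] vn.
have S0 : 0 <= \sum_(i < size s) \sum_(j < Nv) C (nat_of_ord i, nat_of_ord j).
  by apply: sumr_ge0 => i' _; exact: sumr_ge0.
have [vI|vI] := boolP (v \in `[- vmax, vmax]); last first.
  rewrite (Vh_support x h1)// (Vh_support x h2)// subrr expr0n/=.
  by rewrite mulr_ge0 ?inner_xv_ge0// addr_ge0.
move: vI; rewrite in_itv/= => /(vcell_cover Nv_gt0)/(_ vn)[j jlt vj].
have [_ /(_ g1 g2 h1 h2 x v xi vj)/le_trans] := hC (i, j) ilt jlt; apply.
rewrite ler_wpM2r ?inner_xv_ge0//.
rewrite (bigD1 (Ordinal ilt))//= (bigD1 (Ordinal jlt))//= addrCA -addrA lerDl.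
apply: addr_ge0; first by apply: sumr_ge0 => j' _; exact: (C0 (Ordinal ilt) j').
by apply: addr_ge0 => //; apply: sumr_ge0 => i' _; apply: sumr_ge0 => j' _; exact: C0.
Qed.

(** The mean square of one component is at most that of the vector. *)
Lemma Vxh3_sup_bound : exists2 C : R, 0 < C & forall q1 q2,
  Vxh3 a s kappa q1 -> Vxh3 a s kappa q2 ->
  forall x k, xcells a s x ->
  (q1 x k 0 - q2 x k 0) ^+ 2 <= C * inner_x a b (q1 \- q2) (q1 \- q2).
Proof.
have /choice[C hC] : forall i, exists C : R, (i < size s)%N ->
    0 < C /\ forall (p : {poly R}) t, (size p <= kappa.+1)%N -> t \in xcell a s i ->
    ((p.[t] ^+ 2)%:E <= C%:E * \int[mu]_(x in [set` xcell a s i]) (p.[x] ^+ 2)%:E)%E.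
  move=> i; have [ilt|] := boolP (i < size s)%N; last by exists 0.
  have [C C0 hC] := poly_inverse_inequality kappa (xcell_lt hs ilt).
  by exists C => _; split=> // p t sp; rewrite /xcell in_itv/=; exact: hC.
have C0 (i : 'I_(size s)) : 0 <= C i by case: (hC i (ltn_ord i)) => /ltW.
exists (1 + \sum_(i < size s) C i); first by rewrite ltr_pwDl// sumr_ge0.
move=> q1 q2 h1 h2 x k [i /= ilt xi].
have [Ci0 hCi] := hC i ilt.
have [p1 [s1 e1]] := h1 k i ilt.
have [p2 [s2 e2]] := h2 k i ilt.
have sp : (size (p1 - p2)%R <= kappa.+1)%N.
  by rewrite (leq_trans (size_polyD _ _))// size_polyN geq_max s1.
have mI : measurable [set` xcell a s i] by exact: measurable_itv.
pose G x := \sum_(k < 3) (q1 x k 0 - q2 x k 0) ^+ 2.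
have md (k' : 'I_3) : measurable_fun `]a, b[ (fun x => q1 x k' 0 - q2 x k' 0).
  apply: measurable_funB; first exact: (Vxh_measurable hs (h1 k')).
  exact: (Vxh_measurable hs (h2 k')).
have mG : measurable_fun `]a, b[ G.
  by apply: measurable_sum => k'; exact: measurable_funX.
have Gb : mu.-integrable `]a, b[ (EFin \o G).
  apply: measurable_bounded_integrable => //.
    by rewrite /= lebesgue_measure_itv/=; case: ifP => _; rewrite ?ltry.
  have /choice[B hB] : forall k', exists B : R, forall x, `]a, b[%classic x ->
      `|q1 x k' 0 - q2 x k' 0| <= B.
    move=> k'; have [B1 hB1] := Vxh_bounded hs (h1 k').
    have [B2 hB2] := Vxh_bounded hs (h2 k').
    by exists (B1 + B2) => y yab; rewrite (le_trans (ler_normB _ _))// lerD ?hB1 ?hB2.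
  exists (\sum_(k < 3) B k ^+ 2); split; first exact: num_real.
  move=> M BM y yab /=; apply: le_trans (ltW BM).
  rewrite ger0_norm; last by apply: sumr_ge0 => k' _; exact: sqr_ge0.
  apply: ler_sum => k' _; rewrite -(real_normK (num_real _)).
  by have hh := hB k' y yab; rewrite lerXn2r// nnegrE// (le_trans _ hh).
have IE : (\int[mu]_(y in `]a, b[) (G y)%:E)%E = (inner_x a b (q1 \- q2) (q1 \- q2))%:E.
  have E : (\int[mu]_(y in `]a, b[) (G y)%:E = \int[mu]_(y in `]a, b[)
      (\sum_(k < 3) (q1 \- q2) y k 0 * (q1 \- q2) y k 0)%:E)%E.
    by apply: eq_integral => y _; congr EFin; apply: eq_bigr => k' _; rewrite /= !mxE expr2.
  by rewrite /inner_x /Rintegral -E fineK//; exact: integrable_fin_num.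
have inner0 : 0 <= inner_x a b (q1 \- q2) (q1 \- q2).
  rewrite -lee_fin -IE; apply: integral_ge0 => y _; rewrite lee_fin.
  by apply: sumr_ge0 => k' _; exact: sqr_ge0.
apply: (@le_trans _ _ (C i * inner_x a b (q1 \- q2) (q1 \- q2))); last first.
  rewrite ler_wpM2r//.
  by rewrite (bigD1 (Ordinal ilt))//= addrCA lerDl addr_ge0// sumr_ge0.
rewrite -lee_fin [leRHS]EFinM -IE.
have -> : q1 x k 0 - q2 x k 0 = (p1 - p2).[x] by rewrite e1// e2// !hornerE.
apply: le_trans (hCi _ _ sp xi) _.
apply: lee_wpmul2l; first by rewrite lee_fin ltW.
apply: (@le_trans _ _ (\int[mu]_(y in [set` xcell a s i]) (G y)%:E)%E).
  have sub : [set` xcell a s i] `<=` `]a, b[%classic.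
    by move=> y yi; apply: (xcells_sub hs); exists i.
  apply: ge0_le_integral => //.
  - by move=> y _; rewrite lee_fin sqr_ge0.
  - by apply/measurable_EFinP; apply: measurable_funX; exact: measurable_poly.
  - apply/measurable_EFinP; exact: measurable_funS sub mG.
  - move=> y yi; rewrite lee_fin /G.
    have -> : (p1 - p2).[y] = q1 y k 0 - q2 y k 0 by rewrite !hornerE -e1// -e2.
    by rewrite (bigD1 k)//= lerDl sumr_ge0// => k' _; exact: sqr_ge0.
apply: ge0_subset_integral => //.
- by apply/measurable_EFinP.
- by move=> y _; rewrite lee_fin; apply: sumr_ge0 => k' _; exact: sqr_ge0.
- by move=> y yi; apply: (xcells_sub hs); exists i.
Qed.

End DiscreteSpaces.

(** * Convergence of the kinetic terms *)

Section KineticConvergence.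
Context {R : realType} (a b : R) (s : seq R) (hs : itv_partition a b s) (kappa : nat).
Context (vmax : R) (Nv : nat) (vmax_gt0 : 0 < vmax) (Nv_gt0 : (0 < Nv)%N).
Notation mu := (@lebesgue_measure R).
Notation strip := (`]a, b[ `*` [set: R]).
Notation vnodes := (vnodes vmax Nv).
Notation mesh2 := [set t : R * R | t.1 \in s \/ t.2 \in vnodes].

Lemma mesh2P (t : R * R) : strip t -> ~ mesh2 t -> xcells a s t.1 /\ t.2 \notin vnodes.
Proof.
move=> [xab _] nt; split; last by apply/negP => h; apply: nt; right.
by apply: (xcells_cover hs) => //; apply/negP => h; apply: nt; left.
Qed.

Lemma inner_xv_cvg (w : nat -> R -> R -> R) w0 z :
  gauss_cvg strip snd mesh2 (fun l t => w l t.1 t.2) (fun t => w0 t.1 t.2) ->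
  Vhhat a s kappa vmax Nv z ->
  inner_xv a b (w l) z @[l --> \oo] --> inner_xv a b w0 z.
Proof.
move=> hw hz.
have := gauss_cvgM hw (Vhhat_measurable hs vmax_gt0 Nv_gt0 hz)
  (Vhhat_growth hs vmax_gt0 Nv_gt0 hz).
apply: (gauss_cvg_Rintegral (mu := (mu \x mu)%E)).
- exact: measurableX.
- exact: negligible_mesh2.
- by move=> c; exact: integrable_gauss_strip.
Qed.

Lemma gauss_cvg_mulv (w : nat -> R -> R -> R) w0 :
  gauss_cvg strip snd mesh2 (fun l t => w l t.1 t.2) (fun t => w0 t.1 t.2) ->
  gauss_cvg strip snd mesh2 (fun l t => t.2 * w l t.1 t.2) (fun t => t.2 * w0 t.1 t.2).
Proof.
move=> hw.
have -> : (fun t => t.2 * w0 t.1 t.2) = (fun t : R * R => w0 t.1 t.2) \* snd.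
  by apply/funext => t /=; rewrite mulrC.
have -> : (fun l t => t.2 * w l t.1 t.2) = (fun l => (fun t : R * R => w l t.1 t.2) \* snd).
  by apply/funext => l; apply/funext => t /=; rewrite mulrC.
apply: gauss_cvgM => //; last exact: poly_growth_V.
by apply: measurable_funTS; exact: measurable_snd.
Qed.

(** Taking the trace only affects the spatial factors; hence traces are again
    linear combinations of velocity basis functions. *)
Lemma tensor_trace F B w : trace_filter a s kappa F -> tensor (Vxh a s kappa) B w ->
  exists m (c : 'I_m -> R) (psi : 'I_m -> R -> R), (forall k, B (psi k)) /\
  forall v, w y v @[y --> F] --> \sum_(k < m) c k * psi k v.
Proof.
move=> [FF _ Fc] [m [phi [psi [hphi hpsi wE]]]].
exists m, (fun k => lim (phi k y @[y --> F])), psi; split => // v.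
under eq_fun do rewrite wE.
by apply: cvg_lincomb => k; exact: Fc.
Qed.

Lemma Vhhat_trace F z : trace_filter a s kappa F -> Vhhat a s kappa vmax Nv z ->
  measurable_fun setT (fun v => lim (z y v @[y --> F])) /\
  poly_growth setT id (fun v => lim (z y v @[y --> F])).
Proof.
move=> hF hz; have [m [c [psi [hpsi hc]]]] := tensor_trace hF hz.
have [FF _ _] := hF.
have -> : (fun v => lim (z y v @[y --> F])) =
    (fun v => \sum_(k <- index_enum 'I_m) (cst (c k) \* psi k) v).
  by apply/funext => v; apply: cvg_lim (hc v).
split.
  apply: measurable_sum => k; apply: measurable_funM => //.
  exact: Vvhhat_measurable (hpsi k).
apply: poly_growth_sum => k; apply: poly_growthM; first exact: poly_growth_cst.
exact: Vvhhat_growth (hpsi k).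
Qed.

Lemma Rintegral_gauss_cvg (D : set R) (G : nat -> R -> R) G0 : measurable D ->
  gauss_cvg setT id [set` vnodes] G G0 ->
  \int[mu]_(v in D) G l v @[l --> \oo] --> \int[mu]_(v in D) G0 v.
Proof.
move=> mD /(gauss_cvg_sub measurableT (@subsetT _ D)).
apply: (gauss_cvg_Rintegral (mu := mu)) => //; first exact: negligible_vnodes.
move=> c c0; apply: integrableS (integrable_gauss c0) => //.
Qed.

Section Sequence.
Context (f : nat -> R -> R -> R) (f0 : R -> R -> R).
Context (hf : forall l, Vh a s kappa vmax Nv (f l)) (hf0 : Vh a s kappa vmax Nv f0).
Context (f_cvg : cvg_Vh a b f f0).

Lemma Vh_cvg_uniform (e : R) : 0 < e -> \forall l \near \oo, forall x v,
  xcells a s x -> v \notin vnodes -> `|f l x v - f0 x v| <= e.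
Proof.
move=> e0; have [C C0 hC] := Vh_sup_bound hs kappa vmax_gt0 Nv_gt0.
have d0 : 0 < e ^+ 2 / C by rewrite divr_gt0// exprn_gt0.
have /cvgr0_norm_lt/(_ _ d0) := f_cvg.
apply: filterS => l hl x v xs vn.
rewrite -(@ler_pXn2r _ 2)// ?nnegrE ?(ltW e0)// real_normK ?num_real//.
apply: le_trans (hC _ _ (hf l) hf0 x v xs vn) _.
rewrite -ler_pdivlMl// mulrC; apply: le_trans (ler_norm _) _; exact: ltW.
Qed.

(** Eventually |f l - f0| <= 1, and this difference vanishes beyond [vmax]. *)
Lemma Vh_cvg_dominated : exists K : R, \forall l \near \oo, forall x v,
  xcells a s x -> v \notin vnodes -> `|f l x v| <= K * expR (- 1 * v ^+ 2).
Proof.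
have [K K0 hK] := Vh_gauss hs vmax_gt0 Nv_gt0 hf0.
exists (K + expR (vmax ^+ 2)); apply: filterS (Vh_cvg_uniform ltr01) => l hl x v xs vn.
have [vI|vI] := boolP (v \in `[- vmax, vmax]); last first.
  by rewrite (Vh_support x (hf l))// normr0 mulr_ge0 ?addr_ge0 ?expR_ge0.
have -> : f l x v = f0 x v + (f l x v - f0 x v) by ring.
apply: le_trans (ler_normD _ _) _; rewrite mulrDl lerD ?hK//.
  exact: (xcells_sub hs).
apply: le_trans (hl x v xs vn) _; rewrite -expRD -[X in X <= _]expR0 ler_expR.
rewrite mulNr mul1r subr_ge0 -(real_normK (num_real v)) lerXn2r ?nnegrE ?(ltW vmax_gt0)//.
by move: vI; rewrite in_itv/= ler_norml.
Qed.

Lemma Vh_gauss_cvg :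
  gauss_cvg strip snd mesh2 (fun l t => f l t.1 t.2) (fun t => f0 t.1 t.2).
Proof.
split.
- by move=> l; exact: (Vh_measurable hs _ (hf l)).
- exact: (Vh_measurable hs _ hf0).
- move=> t Dt Nt; have [xs vn] := mesh2P Dt Nt.
  apply/cvgrPdist_le => e e0; apply: filterS (Vh_cvg_uniform e0) => l hl.
  by rewrite distrC; exact: hl.
have [K hK] := Vh_cvg_dominated.
exists K, 1; split=> //; apply: filterS hK => l hl t Dt Nt.
by have [xs vn] := mesh2P Dt Nt; exact: hl.
Qed.

(** Bounds that are uniform on the cells pass to limits along a trace filter,
    both for the distance to the limit and for the Gaussian domination. *)
Lemma Vh_trace_gauss_cvg F : trace_filter a s kappa F ->
  gauss_cvg setT id [set` vnodes] (fun l v => lim (f l y v @[y --> F]))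
    (fun v => lim (f0 y v @[y --> F])).
Proof.
move=> hF; have [FF Fx _] := hF.
have tr g : Vh a s kappa vmax Nv g -> measurable_fun setT (fun v => lim (g y v @[y --> F])) /\
    forall v, g y v @[y --> F] --> lim (g y v @[y --> F]).
  move=> hg; have [m [c [psi [hpsi hc]]]] := tensor_trace hF hg.
  have E : (fun v => lim (g y v @[y --> F])) =
      (fun v => \sum_(k <- index_enum 'I_m) (cst (c k) \* psi k) v).
    by apply/funext => v; apply: cvg_lim (hc v).
  split=> [|v]; last by apply/cvg_ex; eexists; exact: hc.
  rewrite E; apply: measurable_sum => k; apply: measurable_funM => //.
  exact: Vvh_measurable (hpsi k).
split.
- by move=> l; case: (tr _ (hf l)).
- by case: (tr _ hf0).
- move=> v _ /negP vn; apply/cvgrPdist_le => e e0; apply: filterS (Vh_cvg_uniform e0) => l hl.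
  have h : `|f0 y v - f l y v| @[y --> F] -->
      `|lim (f0 y v @[y --> F]) - lim (f l y v @[y --> F])|.
    by apply: cvg_norm; apply: cvgB; [case: (tr _ hf0)|case: (tr _ (hf l))].
  apply: (closed_cvg (fun r => r <= e) _ _ _ h); first exact: closed_le.
  by apply: filterS Fx => y ys; rewrite distrC; exact: hl.
have [K hK] := Vh_cvg_dominated.
exists K, 1; split=> //; apply: filterS hK => l hl v _ /negP vn.
have h : `|f l y v| @[y --> F] --> `|lim (f l y v @[y --> F])|.
  by apply: cvg_norm; case: (tr _ (hf l)).
apply: (closed_cvg (fun r => r <= K * expR (- 1 * v ^+ 2)) _ _ _ h); first exact: closed_le.
by apply: filterS Fx => y ys; exact: hl.
Qed.

(** Every term is an integral of f l, or of one of its traces, against a function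
    of polynomial growth. *)
Lemma Aform_cvg z : a < b -> Vhhat a s kappa vmax Nv z ->
  Aform a b s (f l) z @[l --> \oo] --> Aform a b s f0 z.
Proof.
move=> ab hz.
have mc (c : R) : measurable_fun setT (cst c : R -> R) by exact: measurable_cst.
rewrite /Aform; apply: cvgD; [apply: cvgD|apply: cvgD].
- apply: cvgN; apply: inner_xv_cvg (dxh_Vhhat hz).
  exact: gauss_cvg_mulv Vh_gauss_cvg.
- have : {subset interior_nodes a s <= interior_nodes a s} by [].
  move: {1 3 4}(interior_nodes a s) => r; elim: r => [_|xe r IH hr].
    by under eq_fun do rewrite big_nil; rewrite big_nil; exact: cvg_cst.
  under eq_fun do rewrite big_cons; rewrite big_cons; apply: cvgD; last first.
    by apply: IH => y yr; apply: hr; rewrite inE yr orbT.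
  have xei : xe \in interior_nodes a s by apply: hr; rewrite inE eqxx.
  have FR := trace_filter_right hs kappa (interior_nodes_belast xei).
  have FL := trace_filter_left hs kappa (interior_nodes_mesh xei).
  have [mR gR] := Vhhat_trace FR hz.
  have [mL gL] := Vhhat_trace FL hz.
  have mj : measurable_fun setT (fun v => jump (z ^~ v) xe).
    exact: measurable_funB.
  have gj : poly_growth setT id (fun v => jump (z ^~ v) xe).
    have := poly_growthD gL (poly_growthM gR (poly_growth_cst setT id (-1))).
    congr poly_growth; apply/funext => v.
    by rewrite /jump /traceL /traceR /= mulrN1.
  apply: Rintegral_gauss_cvg => //.
  (* The upwind flux is (v - |v|) / 2 times the right trace plus (v + |v|) / 2
     times the left trace. *)
  have mhalf c : measurable_fun setT (fun v : R => v / 2 + c * `|v|).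
    apply: measurable_funD; first exact: measurable_funM.
    apply: measurable_funM => //; exact: measurableT_comp.
  have ghalf c : poly_growth setT id (fun v : R => v / 2 + c * `|v|).
    apply: (poly_growthD (z1 := fun v : R => v / 2) (z2 := fun v => c * `|v|)).
      exact: poly_growthM (poly_growth_V setT id) (poly_growth_cst _ _ _).
    exact: poly_growthM (poly_growth_cst _ _ _) (poly_growth_norm (poly_growth_V setT id)).
  have := gauss_cvgM (gauss_cvgD
     (gauss_cvgM (Vh_trace_gauss_cvg FR) (mhalf (- 2^-1)) (ghalf (- 2^-1)))
     (gauss_cvgM (Vh_trace_gauss_cvg FL) (mhalf 2^-1) (ghalf 2^-1))) mj gj.
  congr (gauss_cvg _ _ _ _ _).
    apply/funext => l; apply/funext => v /=; rewrite /upwind_flux /avg; congr (_ * _).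
    by rewrite /jump /traceL /traceR; field.
  apply/funext => v /=; rewrite /upwind_flux /avg; congr (_ * _).
  by rewrite /jump /traceL /traceR; field.
- have F := trace_filter_right hs kappa (mesh_left hs ab).
  have [m g] := Vhhat_trace F hz.
  apply: Rintegral_gauss_cvg => //.
  have := gauss_cvgM (gauss_cvgM (gauss_cvgM (Vh_trace_gauss_cvg F)
     (@measurable_id _ _ setT) (poly_growth_V setT id)) m g)
     (mc (-1)) (poly_growth_cst setT id (-1)).
  congr (gauss_cvg _ _ _ _ _).
    by apply/funext => l; apply/funext => v /=; rewrite /traceR; ring.
  by apply/funext => v /=; rewrite /traceR; ring.
- have F := trace_filter_left hs kappa (mesh_right hs ab).
  have [m g] := Vhhat_trace F hz.
  apply: Rintegral_gauss_cvg => //.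
  have := gauss_cvgM (gauss_cvgM (gauss_cvgM (Vh_trace_gauss_cvg F)
     (@measurable_id _ _ setT) (poly_growth_V setT id)) m g)
     (mc 1) (poly_growth_cst setT id 1).
  congr (gauss_cvg _ _ _ _ _).
    by apply/funext => l; apply/funext => v /=; rewrite /traceL; ring.
  by apply/funext => v /=; rewrite /traceL; ring.
Qed.

End Sequence.
End KineticConvergence.

(** * Convergence of the Maxwellians *)

Section MaxwellianEstimates.
Context {R : realType}.

(** For eta = (n, n u, n (u^2 + theta) / 2) this is n^2 theta.  It is polynomial
    in eta, and realizability is its positivity together with that of n. *)
Definition variance_defect (eta : 'cV[R]_3) : R := 2 * eta 2%:R 0 * eta 0 0 - eta 1 0 ^+ 2.

Lemma realizable_pos (eta : 'cV[R]_3) : realizable eta -> 0 < eta 0 0 /\ 0 < variance_defect eta.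
Proof.
move=> [n [u [th [n0 th0 ->]]]]; rewrite /variance_defect !mxE /=; split => //.
have -> : 2 * (n * (u ^+ 2 + th) / 2) * n - (n * u) ^+ 2 = n ^+ 2 * th by field.
by rewrite mulr_gt0// exprn_gt0.
Qed.

Lemma Maxwellian_temperature (eta : 'cV[R]_3) : 0 < eta 0 0 ->
  2 * eta 2%:R 0 / eta 0 0 - (eta 1 0 / eta 0 0) ^+ 2 = variance_defect eta / eta 0 0 ^+ 2.
Proof. by move=> n0; rewrite /variance_defect; field; rewrite gt_eqF. Qed.

(** The bounds on the moments confine u to [- B / nmin, B / nmin] and theta to
    [dmin / B^2, 2 B / nmin]; moreover (v - u)^2 >= v^2 / 2 - u^2. *)
Lemma Maxwellian_le_gauss (nmin dmin B : R) : 0 < nmin -> 0 < dmin -> 0 < B ->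
  exists K c : R, 0 < c /\ forall (eta : 'cV[R]_3) v,
    nmin <= eta 0 0 -> dmin <= variance_defect eta -> (forall k, `|eta k 0| <= B) ->
    `|Maxwellian eta v| <= K * expR (- c * v ^+ 2).
Proof.
move=> nm0 dm0 B0; pose U := B / nmin; pose Th := 2 * B / nmin; pose th := dmin / B ^+ 2.
have th0 : 0 < th by rewrite divr_gt0// exprn_gt0.
have Th0 : 0 < Th by rewrite divr_gt0// mulr_gt0.
have U0 : 0 < U by rewrite divr_gt0.
exists (B / Num.sqrt (2 * pi * th) * expR (U ^+ 2 / (2 * Th))), (4 * Th)^-1.
split; first by rewrite invr_gt0 mulr_gt0.
move=> eta v hn hd hB; have n0 : 0 < eta 0 0 := lt_le_trans nm0 hn.
have nB : eta 0 0 <= B := le_trans (ler_norm _) (hB 0).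
rewrite /Maxwellian Maxwellian_temperature//.
set u := eta 1 0 / eta 0 0; set t := variance_defect eta / eta 0 0 ^+ 2.
have t1 : th <= t.
  apply: ler_pM => //; first exact: ltW.
    by rewrite invr_ge0 exprn_ge0// ltW.
  by rewrite lef_pV2 ?posrE ?exprn_gt0// lerXn2r// nnegrE ltW.
have t0 : 0 < t := lt_le_trans th0 t1.
have uU : `|u| <= U.
  rewrite normrM normfV (ger0_norm (ltW n0)).
  by apply: ler_pM; rewrite ?invr_ge0 ?(ltW n0)// lef_pV2.
have tT : t <= Th.
  rewrite /t -Maxwellian_temperature//.
  apply: (@le_trans _ _ (2 * eta 2%:R 0 / eta 0 0)); first by rewrite gerBl sqr_ge0.
  rewrite ler_pdivrMr//; apply: (@le_trans _ _ (2 * B)).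
    by rewrite ler_pM2l// (le_trans (ler_norm _))//; exact: hB.
  by rewrite /Th mulrAC ler_pdivlMr// ler_pM2l// mulr_gt0.
have pi2 (y : R) : 0 < y -> 0 < 2 * pi * y by move=> y0; rewrite !mulr_gt0// pi_gt0.
rewrite ger0_norm; last by rewrite mulr_ge0 ?expR_ge0// divr_ge0 ?sqrtr_ge0// ltW.
rewrite -[leRHS]mulrA -expRD; apply: ler_pM; rewrite ?expR_ge0//.
- by rewrite divr_ge0 ?sqrtr_ge0// ltW.
- apply: ler_pM => //; rewrite ?invr_ge0 ?sqrtr_ge0 ?(ltW n0)//.
  rewrite lef_pV2 ?posrE ?sqrtr_gt0 ?pi2// ler_wsqrtr// ler_pM2l//.
  by rewrite mulr_gt0// pi_gt0.
rewrite ler_expR.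
have E : U ^+ 2 / (2 * Th) + - (4 * Th)^-1 * v ^+ 2 = - ((v ^+ 2 / 2 - U ^+ 2) / (2 * Th)).
  by field; rewrite gt_eqF.
have TT : 0 < 2 * Th by rewrite mulr_gt0.
rewrite E mulNr lerN2.
apply: (@le_trans _ _ ((v - u) ^+ 2 / (2 * Th))).
  rewrite ler_pM2r ?invr_gt0//.
  have uu : u ^+ 2 <= U ^+ 2.
    by rewrite -(real_normK (num_real u)) lerXn2r ?nnegrE// ltW.
  have := sqr_ge0 (v - 2 * u); nra.
rewrite ler_wpM2l ?sqr_ge0// lef_pV2 ?posrE//; last by rewrite mulr_gt0.
by rewrite ler_pM2l.
Qed.

Lemma Maxwellian_cvg (eta : nat -> 'cV[R]_3) (eta0 : 'cV[R]_3) v :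
  (forall k, eta l k 0 @[l --> \oo] --> eta0 k 0) ->
  0 < eta0 0 0 -> 0 < variance_defect eta0 ->
  Maxwellian (eta l) v @[l --> \oo] --> Maxwellian eta0 v.
Proof.
move=> h n0 d0; have n0' : eta0 0 0 != 0 by rewrite gt_eqF.
have hu : eta l 1 0 / eta l 0 0 @[l --> \oo] --> eta0 1 0 / eta0 0 0.
  by apply: cvgM => //; apply: cvgV.
have ht : 2 * eta l 2%:R 0 / eta l 0 0 - (eta l 1 0 / eta l 0 0) ^+ 2 @[l --> \oo] -->
    2 * eta0 2%:R 0 / eta0 0 0 - (eta0 1 0 / eta0 0 0) ^+ 2.
  apply: cvgB; last by apply: (cvg_comp _ (fun x => x ^+ 2) hu); exact: exprn_continuous.
  by apply: cvgM; [apply: cvgMr|apply: cvgV].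
have t0 : 0 < 2 * eta0 2%:R 0 / eta0 0 0 - (eta0 1 0 / eta0 0 0) ^+ 2.
  by rewrite Maxwellian_temperature// divr_gt0// exprn_gt0.
rewrite /Maxwellian; apply: cvgM.
  apply: cvgM => //; apply: cvgV.
    by rewrite gt_eqF// sqrtr_gt0 !mulr_gt0// pi_gt0.
  apply: continuous_cvg; first exact: sqrt_continuous.
  by apply: cvgM; [exact: cvg_cst|exact: ht].
apply: continuous_cvg; first exact: continuous_expR.
apply: cvgM.
  apply: cvgN; apply: (cvg_comp _ (fun x => x ^+ 2) (cvgB (cvg_cst v) hu)).
  exact: exprn_continuous.
apply: cvgV; first by rewrite gt_eqF// mulr_gt0.
by apply: cvgM; [exact: cvg_cst|exact: ht].
Qed.

Lemma measurable_inv : measurable_fun [set: R] (@GRing.inv R).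
Proof.
apply: (@measurable_off_seq _ _ [:: 0]) => //.
have -> : setT `\` [set` [:: (0 : R)]] = [set x : R | x != 0].
  apply/seteqP; split=> [x [_ /= /negP]|x /= x0]; first by rewrite inE.
  by split=> //=; apply/negP; rewrite inE.
apply: open_continuous_measurable_fun; first exact: open_neq.
by move=> x; rewrite inE /= => x0; exact: inv_continuous.
Qed.

Lemma measurable_Mfield (a b : R) (eta : R -> 'cV[R]_3) :
  (forall k, measurable_fun `]a, b[ (fun x => eta x k 0)) ->
  measurable_fun (`]a, b[ `*` [set: R]) (fun t : R * R => Mfield eta t.1 t.2).
Proof.
move=> me.
have m1 k : measurable_fun (`]a, b[ `*` [set: R]) (fun t : R * R => eta t.1 k 0).
  apply: (@measurable_comp _ _ _ _ _ _ `]a, b[%classic (fun x => eta x k 0)) => //.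
  - by move=> _ [t [It _] <-].
  - by apply: measurable_funTS; exact: measurable_fst.
have mv : measurable_fun (`]a, b[ `*` [set: R]) (fun t : R * R => t.2).
  by apply: measurable_funTS; exact: measurable_snd.
have minv (g : R * R -> R) : measurable_fun (`]a, b[ `*` [set: R]) g ->
    measurable_fun (`]a, b[ `*` [set: R]) (fun t => (g t)^-1).
  by move=> mg; apply: measurableT_comp mg; exact: measurable_inv.
have mu : measurable_fun (`]a, b[ `*` [set: R]) (fun t : R * R => eta t.1 1 0 / eta t.1 0 0).
  by apply: measurable_funM => //; exact: minv.
have mt : measurable_fun (`]a, b[ `*` [set: R]) (fun t : R * R =>
    2 * eta t.1 2%:R 0 / eta t.1 0 0 - (eta t.1 1 0 / eta t.1 0 0) ^+ 2).
  apply: measurable_funB; last exact: measurable_funX.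
  by apply: measurable_funM; [exact: measurable_funM|exact: minv].
rewrite /Mfield /Maxwellian; apply: measurable_funM.
  apply: measurable_funM => //; apply: minv.
  have ms : measurable_fun setT (@Num.sqrt R).
    by apply: continuous_measurable_fun; exact: sqrt_continuous.
  by apply: (measurableT_comp ms); exact: measurable_funM.
apply: measurableT_comp; first exact: measurable_expR.
apply: measurable_funM; last by apply: minv; exact: measurable_funM.
by apply: measurable_funN; apply: measurable_funX; exact: measurable_funB.
Qed.

End MaxwellianEstimates.

Lemma exists_uniform_pos (R : realDomainType) (n : nat) (P : nat -> R -> Prop) :
  (forall i m m', m' <= m -> P i m -> P i m') ->
  (forall i, (i < n)%N -> exists2 m, 0 < m & P i m) ->
  exists2 m, 0 < m & forall i, (i < n)%N -> P i m.
Proof.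
move=> mono; elim: n => [_|n IH h]; first by exists 1.
have [m m0 hm] := IH (fun i ilt => h i (leqW ilt)).
have [m' m'0 hm'] := h n (leqnn _).
exists (Num.min m m'); first by rewrite lt_min m0.
move=> i; rewrite ltnS leq_eqVlt => /orP[/eqP ->|ilt].
  by apply: mono hm'; rewrite ge_min lexx orbT.
by apply: mono (hm i ilt); rewrite ge_min lexx.
Qed.

(** Positivity at both end points makes the minimum over the closed interval
    positive. *)
Lemma poly_pos_min (R : realType) (c d : R) (p : {poly R}) : c < d ->
  0 < p.[c] -> 0 < p.[d] -> {in `]c, d[, forall x, 0 < p.[x]} ->
  exists2 m, 0 < m & {in `]c, d[, forall x, m <= p.[x]}.
Proof.
move=> cd pc pd pI.
have [x xI xmin] := @EVT_min R (horner p) c d (ltW cd)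
  (continuous_subspaceT (@continuous_horner R p)).
exists p.[x]; last by move=> y yI; apply: xmin; exact: subset_itv_oo_cc yI.
move: xI; rewrite in_itv/= => /andP[]; rewrite le_eqVlt => /orP[/eqP <- //|cx].
rewrite le_eqVlt => /orP[/eqP -> //|xd].
by apply: pI; rewrite in_itv/= cx.
Qed.

Section FluidConvergence.
Context {R : realType} (a b : R) (s : seq R) (hs : itv_partition a b s) (kappa : nat).
Context (vmax : R) (Nv : nat) (vmax_gt0 : 0 < vmax) (Nv_gt0 : (0 < Nv)%N).
Notation strip := (`]a, b[ `*` [set: R]).
Notation mesh2 := [set t : R * R | t.1 \in s \/ t.2 \in vnodes vmax Nv].

(** On a cell, n and n^2 theta are polynomials in x.  The trace conditions of
    [realizable_field] are their positivity at the end points of the cell. *)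
Lemma realizable_field_bounds (q : R -> 'cV[R]_3) :
  Vxh3 a s kappa q -> realizable_field a s q ->
  exists2 m, 0 < m & forall x, xcells a s x -> m <= q x 0 0 /\ m <= variance_defect (q x).
Proof.
move=> hq [hin hR hL].
have [m m0 hm] : exists2 m, 0 < m & forall i, (i < size s)%N ->
    forall x, x \in xcell a s i -> m <= q x 0 0 /\ m <= variance_defect (q x).
  apply: exists_uniform_pos.
    by move=> i m m' mm h x xi; have [h1 h2] := h x xi; split; exact: le_trans mm _.
  move=> i ilt; have lt := xcell_lt hs ilt.
  have /choice[p hp] : forall k, exists p : {poly R}, {in xcell a s i, forall y, q y k 0 = p.[y]}.
    by move=> k; have [p [_ hp]] := hq k i ilt; exists p.
  pose dp := (2%:P * p 2%:R * p 0 - p 1 ^+ 2).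
  have dpE x (e : 'cV[R]_3) : (forall k, e k 0 = (p k).[x]) -> dp.[x] = variance_defect e.
    by move=> h; rewrite /dp /variance_defect !h !hornerE.
  have pI x : x \in xcell a s i -> 0 < (p 0).[x] /\ 0 < dp.[x].
    move=> xi; rewrite (dpE x (q x)); last by move=> k; exact: hp.
    by rewrite -hp//; apply: realizable_pos; apply: hin; exists i.
  have pc : 0 < (p 0).[nth a (a :: s) i] /\ 0 < dp.[nth a (a :: s) i].
    have /realizable_pos : realizable (\col_k traceR (fun y => q y k 0) (nth a (a :: s) i)).
      apply: hR; have -> : nth a (a :: s) i = nth a (belast a s) i.
        by rewrite [a :: s]lastI nth_rcons size_belast ilt.
      by rewrite mem_nth// size_belast.
    have tE k : traceR (fun y => q y k 0) (nth a (a :: s) i) = (p k).[nth a (a :: s) i].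
      by apply: cvg_lim => //; apply: cvg_right_poly lt _; exact: hp.
    rewrite -(dpE (nth a (a :: s) i)); last by move=> k; rewrite mxE tE.
    by rewrite mxE tE.
  have pd : 0 < (p 0).[nth a (a :: s) i.+1] /\ 0 < dp.[nth a (a :: s) i.+1].
    have /realizable_pos : realizable (\col_k traceL (fun y => q y k 0) (nth a (a :: s) i.+1)).
      by apply: hL; rewrite /= mem_nth.
    have tE k : traceL (fun y => q y k 0) (nth a (a :: s) i.+1) = (p k).[nth a (a :: s) i.+1].
      by apply: cvg_lim => //; apply: cvg_left_poly lt _; exact: hp.
    rewrite -(dpE (nth a (a :: s) i.+1)); last by move=> k; rewrite mxE tE.
    by rewrite mxE tE.
  have [m1 m10 h1] := poly_pos_min lt pc.1 pd.1 (fun x xi => (pI x xi).1).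
  have [m2 m20 h2] := poly_pos_min lt pc.2 pd.2 (fun x xi => (pI x xi).2).
  exists (Num.min m1 m2); first by rewrite lt_min m10.
  move=> x xi; rewrite -(dpE x (q x)); last by move=> k; exact: hp.
  by rewrite hp// !ge_min h1// h2// orbT.
by exists m => // x [i /= ilt xi]; exact: hm xi.
Qed.

Section Sequence.
Context (rho : nat -> R -> 'cV[R]_3) (rho0 : R -> 'cV[R]_3).
Context (hrho : forall l, Vxh3 a s kappa (rho l)) (hrho0 : Vxh3 a s kappa rho0).
Context (hreal : realizable_field a s rho0) (rho_cvg : cvg_Vxh3 a b rho rho0).

Lemma Vxh3_cvg_uniform (e : R) : 0 < e -> \forall l \near \oo, forall x k,
  xcells a s x -> `|rho l x k 0 - rho0 x k 0| <= e.
Proof.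
move=> e0; have [C C0 hC] := Vxh3_sup_bound hs kappa.
have d0 : 0 < e ^+ 2 / C by rewrite divr_gt0// exprn_gt0.
have /cvgr0_norm_lt/(_ _ d0) := rho_cvg.
apply: filterS => l hl x k xs.
rewrite -(@ler_pXn2r _ 2)// ?nnegrE ?(ltW e0)// real_normK ?num_real//.
apply: le_trans (hC _ _ (hrho l) hrho0 x k xs) _.
rewrite -ler_pdivlMl// mulrC; apply: le_trans (ler_norm _) _; exact: ltW.
Qed.

(** The limit is stated for any field [eta] that agrees with [rho0] on the open
    cells: the two Maxwellians then differ on a null set at most. *)
Lemma Mfield_gauss_cvg (eta : R -> 'cV[R]_3) : {in xcells a s, rho0 =1 eta} ->
  gauss_cvg strip snd mesh2 (fun l t => Mfield (rho l) t.1 t.2) (fun t => Mfield eta t.1 t.2).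
Proof.
move=> rhoE; have [m m0 hm] := realizable_field_bounds hrho0 hreal.
split.
- by move=> l; apply: measurable_Mfield => k; exact: (Vxh_measurable hs (hrho l k)).
- apply: measurable_Mfield => k; apply: (@measurable_off_seq _ _ s) => //.
  apply: (@eq_measurable_fun _ _ _ _ _ (fun x => rho0 x k 0)).
    move=> x; rewrite inE => -[xab /= /negP xs]; rewrite rhoE// inE.
    exact: (xcells_cover hs).
  by apply: measurable_funS (Vxh_measurable hs (hrho0 k)) => // x [].
- move=> t Dt Nt; have [xs vn] := mesh2P hs Dt Nt.
  rewrite /Mfield -rhoE ?inE//; have [h1 h2] := hm _ xs.
  apply: Maxwellian_cvg; [|exact: lt_le_trans h1|exact: lt_le_trans h2].
  move=> k; apply/cvgrPdist_le => e e0; apply: filterS (Vxh3_cvg_uniform e0) => l hl.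
  by rewrite distrC; exact: hl.
have /choice[B hB] : forall k, exists B : R, forall x, xcells a s x -> `|rho0 x k 0| <= B.
  by move=> k; have [B hB] := Vxh_bounded hs (hrho0 k); exists B => x /(xcells_sub hs)/hB.
pose M := \sum_k `|B k|.
have hM x k : xcells a s x -> `|rho0 x k 0| <= M.
  move=> xs; apply: le_trans (hB k x xs) _; apply: le_trans (ler_norm _) _.
  by rewrite /M (bigD1 k)//= lerDl sumr_ge0.
have M0 : 0 <= M by exact: sumr_ge0.
(* Perturbing each moment, of size at most M, by at most e <= 1 changes
   [variance_defect] by at most e (6 M + 3), which is to be at most m / 2. *)
pose e := Num.min 1 (Num.min (m / 2) (m / (12 * M + 6))).
have e0 : 0 < e by rewrite !lt_min ltr01 !divr_gt0//= ltr_wpDl// mulr_ge0.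
have e1 : e <= 1 by rewrite ge_min lexx.
have e2 : e <= m / 2 by rewrite !ge_min lexx orbT.
have e3 : e * (12 * M + 6) <= m.
  by rewrite -ler_pdivlMr ?ltr_wpDl ?mulr_ge0// !ge_min lexx !orbT.
have mh : 0 < m / 2 by rewrite divr_gt0.
have [K [c [c0 hK]]] := Maxwellian_le_gauss mh mh (ltr_wpDl M0 (@ltr01 R)).
exists K, c; split => //; apply: filterS (Vxh3_cvg_uniform e0) => l hl t Dt Nt.
have [xs vn] := mesh2P hs Dt Nt.
have near k : `|rho l t.1 k 0 - rho0 t.1 k 0| <= e by exact: hl.
have bd k : `|rho0 t.1 k 0| <= M by exact: hM.
have [h1 h2] := hm _ xs.
apply: hK.
- by have := near 0; rewrite ler_norml => /andP[]; lra.
- move: h2; rewrite /variance_defect.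
  move: (near 0) (near 1) (near 2%:R) (bd 0) (bd 1) (bd 2%:R).
  move: (rho l t.1 0 0) (rho l t.1 1 0) (rho l t.1 2%:R 0).
  move: (rho0 t.1 0 0) (rho0 t.1 1 0) (rho0 t.1 2%:R 0) => n0 u0 w0 n u w.
  have -> : n = n0 + (n - n0) by ring.
  have -> : u = u0 + (u - u0) by ring.
  have -> : w = w0 + (w - w0) by ring.
  move: (n - n0) (u - u0) (w - w0) => dn du dw.
  rewrite !(addrAC _ _ (- _)) !subrr !add0r => ndn ndu ndw nn nu nw h2.
  have prod x y X Y : `|x| <= X -> `|y| <= Y -> `|x * y| <= X * Y :> R.
    by move=> ? ?; rewrite normrM; exact: ler_pM.
  have := prod _ _ _ _ ndw nn; have := prod _ _ _ _ nw ndn; have := prod _ _ _ _ ndw ndn.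
  have := prod _ _ _ _ nu ndu; have := prod _ _ _ _ ndu ndu.
  have ee : e * e <= e by rewrite ler_piMl// ltW.
  rewrite !ler_norml => /andP[p1 p2] /andP[p3 p4] /andP[p5 p6] /andP[p7 p8] /andP[p9 p10].
  nra.
- move=> k; have -> : rho l t.1 k 0 = rho0 t.1 k 0 + (rho l t.1 k 0 - rho0 t.1 k 0) by ring.
  by apply: le_trans (ler_normD _ _) _; rewrite lerD// (le_trans (near k)).
Qed.

End Sequence.
End FluidConvergence.

(** * Passage to the limit *)

Theorem proposition3p2 (R : realType) (a b : R) (s : seq R) (kappa : nat)
    (vmax : R) (Nv : nat) (dt nu : R)
    (inflow : (R -> R -> R) -> (R -> R -> R))
    (fk : R -> R -> R)
    (f : nat -> R -> R -> R) (rho : nat -> R -> 'cV[R]_3)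
    (fstar : R -> R -> R) (rhostar : R -> 'cV[R]_3)
    (hab : a < b) (hs : itv_partition a b s)
    (hvmax : 0 < vmax) (hNv : (0 < Nv)%N) (hNv_even : ~~ odd Nv)
    (hdt : 0 < dt) (hnu : 0 < nu)
    (hinflow : inflow_continuous a b s kappa vmax Nv inflow)
    (hfk : Vh a s kappa vmax Nv fk)
    (hf : forall l, Vh a s kappa vmax Nv (f l))
    (hrho : forall l, Vxh3 a s kappa (rho l))
    (hrho_real : forall l, realizable_field a s (rho l.+1))
    (hrhof_real : forall l, realizable_field a s (moments (f l)))
    (hHO : forall l z, Vhhat a s kappa vmax Nv z ->
       inner_xv a b (f l.+1) z + dt * Lform a b s nu (f l.+1) z =
       inner_xv a b fk z + dt * nu * inner_xv a b (Mfield (rho l.+1)) z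
       - dt * Bform a b (inflow (f l)) z)
    (hLO : forall l q, Vxh3 a s kappa q ->
       inner_x a b (rho l.+1) q + dt * Eform a b s (rho l.+1) q =
       inner_x a b (moments fk) q
       - dt * (Aform a b s (f l) (edot q) - Eform a b s (moments (f l)) q)
       - dt * Bform a b (inflow (f l)) (edot q))
    (hfstar : Vh a s kappa vmax Nv fstar)
    (hrhostar : Vxh3 a s kappa rhostar)
    (hrhostar_real : realizable_field a s rhostar)
    (hrhofstar_real : realizable_field a s (moments fstar))
    (hf_cvg : cvg_Vh a b f fstar)
    (hrho_cvg : cvg_Vxh3 a b rho rhostar)
    (hconsistent : {in xcells a s, rhostar =1 moments fstar}) :
  forall z, Vhhat a s kappa vmax Nv z ->
    inner_xv a b fstar z + dt * Lform a b s nu fstar z =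
    inner_xv a b fk z + dt * nu * inner_xv a b (Mfield (moments fstar)) z
    - dt * Bform a b (inflow fstar) z.
Proof.
move=> z hz.
have gf : cvg_Vh a b (fun l => f l.+1) fstar.
  by rewrite /cvg_Vh (cvg_shiftS (fun l => inner_xv a b (f l \- fstar) (f l \- fstar))).
have grho : cvg_Vxh3 a b (fun l => rho l.+1) rhostar.
  rewrite /cvg_Vxh3.
  by rewrite (cvg_shiftS (fun l => inner_x a b (rho l \- rhostar) (rho l \- rhostar))).
have hf1 l : Vh a s kappa vmax Nv (f l.+1) by exact: hf.
have Ff := Vh_gauss_cvg hs hvmax hNv hf1 hfstar gf.
have cf := inner_xv_cvg hs hvmax hNv (w := fun l => f l.+1) (w0 := fstar) Ff hz.
have cA := Aform_cvg hs hvmax hNv hf1 hfstar gf hab hz.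
have cM := inner_xv_cvg hs hvmax hNv
  (w := fun l => Mfield (rho l.+1)) (w0 := Mfield (moments fstar))
  (Mfield_gauss_cvg hs vmax Nv (fun l => hrho l.+1) hrhostar hrhostar_real grho hconsistent) hz.
have cB := hinflow f fstar hf hfstar hf_cvg z hz.
have lhs : inner_xv a b (f l.+1) z + dt * Lform a b s nu (f l.+1) z @[l --> \oo] -->
    inner_xv a b fstar z + dt * Lform a b s nu fstar z.
  apply: cvgD => //; apply: cvgM; first exact: cvg_cst.
  apply: cvgD => //; apply: cvgM => //; exact: cvg_cst.
have rhs : inner_xv a b fk z + dt * nu * inner_xv a b (Mfield (rho l.+1)) z
       - dt * Bform a b (inflow (f l)) z @[l --> \oo] -->
    inner_xv a b fk z + dt * nu * inner_xv a b (Mfield (moments fstar)) z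
    - dt * Bform a b (inflow fstar) z.
  apply: cvgB; last by apply: cvgM => //; exact: cvg_cst.
  apply: cvgD; first exact: cvg_cst.
  by apply: cvgM => //; exact: cvg_cst.
move: lhs; under eq_fun do rewrite hHO//.
by move=> lhs; exact: cvg_unique lhs rhs.
Qed.
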